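(* Let $K$ be a finite subset of the closed unit disc in $\mathbb{C}$. A sequence $x\in K^{\mathbb{N}}$ is weakly correlated to some sequence $y\in K^{\mathbb{N}}$ generic for an ergodic measure on $K^{\mathbb{N}}$ if and only if $x$ is semi-generic for at least one shift-invariant Borel probability measure $\mu$ on $K^{\mathbb{N}}$ that is correlated to an ergodic measure on $K^{\mathbb{N}}$.
   Context: $\mathbb{N}=\{1,2,\dots\}$; $K^{\mathbb{N}}$ carries the left shift, and ''ergodic measure'' means an ergodic shift-invariant Borel probability measure. For a shift-invariant probability measure $\mu$ and a block $B\in K^m$, $\mu(B)$ denotes the measure of the cylinder determined by $B$ at coordinates $1,\dots,m$. A point $x\in K^{\mathbb{N}}$ semi-generates $\mu$ along a strictly increasing sequence $(n_k)$ of positive integers if for every $m\ge1$ and every $B\in K^m$, $\mu(B)=\lim_k\frac1{n_k}\#\{i\in\{1,\dots,n_k\}:[x_i,\dots,x_{i+m-1}]=B\}$; $x$ is semi-generic for $\mu$ if it semi-generates $\mu$ along some such $(n_k)$; $x$ is generic for $\mu$ if this holds with $n_k=k$. For blocks $A=[a_1,\dots,a_n]$, $B=[b_1,\dots,b_n]$ of complex numbers put $\mathsf{corr}(A,B)=\frac1n\sum_{i=1}^n a_i\overline{b_i}-\bigl(\frac1n\sum_{i=1}^n a_i\bigr)\bigl(\frac1n\sum_{i=1}^n\overline{b_i}\bigr)$. Two bounded sequences $x,y$ are weakly correlated if $\limsup_n|\mathsf{corr}([x_1,\dots,x_n],[y_1,\dots,y_n])|>0$. For shift-invariant probability measures $\mu,\nu$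 on $K^{\mathbb{N}}$, $\mathsf{corr}(\mu,\nu)=\sup_\xi\left|\int x_1\overline{y_1}\,d\xi-\int x_1\,d\mu\cdot\int\overline{y_1}\,d\nu\right|$, where $\xi$ ranges over all joinings of $\mu$ and $\nu$ (shift-invariant probability measures on $K^{\mathbb{N}}\times K^{\mathbb{N}}$ with marginals $\mu$ and $\nu$) and $x_1,y_1$ denote the first-symbol functions. The measures are correlated if $\mathsf{corr}(\mu,\nu)\neq0$. *)

(* Defs.v *)
From HB Require Import structures.
From mathcomp Require Import all_boot all_order all_algebra finmap.
From mathcomp Require Import complex.
From mathcomp Require Import all_classical all_reals all_analysis.

Set Implicit Arguments.
Unset Strict Implicit.
Unset Printing Implicit Defensive.

Import Order.TTheory GRing.Theory Num.Theory.
Import numFieldNormedType.Exports.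
Import Normc.

Local Open Scope classical_set_scope.
Local Open Scope ring_scope.
Local Open Scope complex_scope.

(** The paper indexes sequences by 1, 2, 3, ...; here the coordinates of a
    sequence are 0, 1, 2, ..., so that [x i] is the paper's $x_{i+1}$. *)

Section measure_preserving.
Context {d : measure_display} {X : measurableType d} {R : realType}.

Definition measure_invariant (T : X -> X) (mu : probability X R) : Prop :=
  forall A : set X, measurable A -> mu (T @^-1` A) = mu A.

Definition ergodic_measure (T : X -> X) (mu : probability X R) : Prop :=
  measure_invariant T mu /\
  forall A : set X, measurable A -> T @^-1` A = A -> mu A = 0%E \/ mu A = 1%E.

(** Used for bounded measurable functions only. *)
Definition cintegral (mu : probability X R) (f : X -> R[i]) : R[i] :=
  (\int[mu]_z complex.Re (f z)) +i* (\int[mu]_z complex.Im (f z)).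

End measure_preserving.

(** The sequence space $A^{\mathbb{N}}$ of a discrete alphabet, with the Borel
    sigma-algebra of the product topology.  A finite subset of the complex
    plane inherits the discrete topology, so this covers the alphabets below. *)
Definition seqspace (A : pointedType) : Type :=
  g_sigma_algebraType (@open {ptws nat -> discrete_topology A}).

HB.instance Definition _ (A : pointedType) :=
  Measurable.copy (seqspace A)
    (g_sigma_algebraType (@open {ptws nat -> discrete_topology A})).

Section symbolic.
Context {A : pointedType} {R : realType}.
Implicit Types (x : seqspace A) (mu : probability (seqspace A) R).

Definition left_shift x : seqspace A := fun i => x i.+1.

Definition cylinder (m : nat) (B : m.-tuple A) : set (seqspace A) :=
  [set x | [tuple x j | j < m] = B].

Definition block_freq x (m : nat) (B : m.-tuple A) (n : nat) : R :=
  #|[pred i : 'I_n | [tuple x (i + j)%N | j < m] == B]|%:R / n%:R.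

Definition semi_generates x mu (nk : nat -> nat) : Prop :=
  forall (m : nat) (B : m.-tuple A), (0 < m)%N ->
    block_freq x B (nk k) @[k --> \oo] --> fine (mu (cylinder B)).

Definition semi_generic x mu : Prop :=
  exists nk : nat -> nat,
    [/\ (forall k, 0 < nk k)%N, {homo nk : i j / (i < j)%N} &
        semi_generates x mu nk].

Definition generic x mu : Prop := semi_generates x mu succn.

End symbolic.

Section sequence_correlation.
Context {R : realType}.

Definition block_corr (n : nat) (a b : n.-tuple R[i]) : R[i] :=
  n%:R^-1 * (\sum_(i < n) tnth a i * (tnth b i)^*)
  - (n%:R^-1 * \sum_(i < n) tnth a i) * (n%:R^-1 * \sum_(i < n) (tnth b i)^*).

(** Used for bounded sequences only: [limn_sup] is real-valued. *)
Definition weakly_correlated (x y : nat -> R[i]) : Prop :=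
  0 < limn_sup (fun n =>
    normc (block_corr [tuple x i | i < n.+1] [tuple y i | i < n.+1])).

End sequence_correlation.

(** [measurableType]s are pointed, hence the nonemptiness proof: it only serves
    to provide the (irrelevant) distinguished point. *)
Definition alphabet {R : realType} {K : {fset R[i]}} (K0 : K != fset0) : Type :=
  K.

Section alphabet.
Context {R : realType} {K : {fset R[i]}} (K0 : K != fset0).

HB.instance Definition _ := Finite.copy (alphabet K0) K.

Let alphabet_point : alphabet K0 := FSetSub (xchooseP (fset0Pn K K0)).

HB.instance Definition _ := isPointed.Build (alphabet K0) alphabet_point.

Definition symbol (a : alphabet K0) : R[i] := fsval a.

End alphabet.

Section measure_correlation.
Context {R : realType} {K : {fset R[i]}} {K0 : K != fset0}.
Local Notation X := (seqspace (alphabet K0)).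
Implicit Types mu nu : probability X R.

Definition values (x : X) : nat -> R[i] := fun i => symbol (K0 := K0) (x i).

Definition joining mu nu : set (probability (X * X)%type R) :=
  [set xi | [/\ measure_invariant (fun z : X * X => (left_shift z.1, left_shift z.2)) xi,
      forall A : set X, measurable A -> xi (fst @^-1` A) = mu A &
      forall A : set X, measurable A -> xi (snd @^-1` A) = nu A]].

Definition measure_corr mu nu : R :=
  sup [set normc (cintegral xi (fun z : X * X =>
                     values z.1 0%N * (values z.2 0%N)^*)
                  - cintegral mu (fun x : X => values x 0%N)
                    * cintegral nu (fun y : X => (values y 0%N)^*))
      | xi in joining mu nu].

Definition correlated mu nu : Prop := measure_corr mu nu <> 0.

End measure_correlation.

(* Main.v *)
(** If [x] is weakly correlated to a generic [y], an ultrafilter concentrated on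
    times at which the correlation stays away from [0] makes all cylinder
    frequencies of the pair [(x, y)] converge; by compactness of the sequence
    space the limits extend to an invariant measure, which is a joining of [nu]
    and a measure [mu] semi-generated by [x], and its correlation is the limit of
    those of the initial blocks, hence nonzero.

    Conversely let [xi] be a joining of [mu] and the ergodic [nu] whose
    correlation [c] is nonzero, and let [psi a b] be the real part of
    [conj c * a * conj b].  By ergodicity most [nu]-blocks of a large length [L]
    have cylinder frequencies at most slightly above those of [nu], and such upper
    bounds survive arbitrary concatenation.  Replace each [L]-block [u] of [x] by
    a typical block [v] maximizing the sum of the [psi (u_i) (v_i)].  Averaged
    over the [L] possible offsets, the resulting sums of [psi] are at least the
    average over [x] of this maximum, which converges to its [mu]-integral, and
    that is almost [L] times the [xi]-integral of [psi].  Passing from one stage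
    to a finer one at sparse times yields [y], which is generic for [nu] because
    upper bounds on the frequencies of all blocks of a given length force
    equality. *)
Require Import Defs.
From HB Require Import structures.
From mathcomp Require Import all_boot all_order all_algebra finmap.
From mathcomp Require Import complex.
From mathcomp Require Import all_classical all_reals all_analysis.
From mathcomp Require Import measurable_realfun.
From mathcomp Require Import ring lra zify.

Set Implicit Arguments.
Unset Strict Implicit.
Unset Printing Implicit Defensive.
Import Order.TTheory GRing.Theory Num.Theory.
Import numFieldNormedType.Exports.
Import Normc.
Local Open Scope classical_set_scope.
Local Open Scope ring_scope.
Local Open Scope complex_scope.

#[short(type="finPointedType")]
HB.structure Definition FinPointed := {A of Finite A & Pointed A}.

HB.instance Definition _ (R : realType) (K : {fset R[i]}) (K0 : K != fset0) :=
  Finite.on (alphabet K0).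
(** Products of alphabets are alphabets again, so a pair of sequences can be read as one sequence
    over [A * A]. *)
HB.instance Definition _ (A B : finPointedType) := Finite.on (A * B)%type.

(** * Cylinders and clopen sets of the sequence space *)

Section sequence_space.
Context {A : finPointedType}.
Implicit Types (x y : seqspace A) (C D : set (seqspace A)).

Definition prefix m x : m.-tuple A := [tuple x j | j < m].

Lemma prefixP m x y :
  prefix m x = prefix m y <-> (forall j, (j < m)%N -> x j = y j).
Proof.
split=> [xy j jm|xy]; last by apply: eq_mktuple => j; exact: xy.
by have := congr1 (fun B => tnth B (Ordinal jm)) xy; rewrite !tnth_mktuple.
Qed.

Definition depends_on_prefix m C :=
  forall x y, prefix m x = prefix m y -> C x -> C y.

(** Since the alphabet is finite, compactness makes these exactly the subsets that are both closed
    and open. *)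
Definition clopen_set : set (set (seqspace A)) :=
  [set C | exists m, depends_on_prefix m C].

Lemma depends_on_prefixW m n C :
  (m <= n)%N -> depends_on_prefix m C -> depends_on_prefix n C.
Proof.
move=> mn Cm x y /prefixP xy; apply: Cm; apply/prefixP => j jm.
exact/xy/(leq_trans jm).
Qed.

Lemma depends_on_prefixI m n C D : depends_on_prefix m C ->
  depends_on_prefix n D -> depends_on_prefix (maxn m n) (C `&` D).
Proof.
move=> Cm Dn x y xy [Cx Dx]; split.
- exact: (depends_on_prefixW (leq_maxl m n) Cm) Cx.
- exact: (depends_on_prefixW (leq_maxr m n) Dn) Dx.
Qed.

Lemma depends_on_prefixC m C :
  depends_on_prefix m C -> depends_on_prefix m (~` C).
Proof. by move=> Cm x y xy Cx Cy; exact/Cx/(Cm y). Qed.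

Lemma clopen_setI : setI_closed clopen_set.
Proof.
by move=> C D [m Cm] [n Dn]; exists (maxn m n); exact: depends_on_prefixI.
Qed.

Lemma clopen_setC C : clopen_set C -> clopen_set (~` C).
Proof. by move=> [m Cm]; exists m; exact: depends_on_prefixC. Qed.

Lemma clopen_setU : setU_closed clopen_set.
Proof.
move=> C D mC mD; rewrite -[C `|` D]setCK setCU.
by apply: clopen_setC; apply: clopen_setI; exact: clopen_setC.
Qed.

Lemma clopen_set0 : clopen_set set0.
Proof. by exists 0%N. Qed.

Lemma clopen_setT : clopen_set setT.
Proof. by exists 0%N. Qed.

Lemma depends_on_cylinder m (B : m.-tuple A) : depends_on_prefix m (cylinder B).
Proof. by move=> x y; rewrite /cylinder/= -!/(prefix _ _) => ->. Qed.

Lemma clopen_cylinder m (B : m.-tuple A) : clopen_set (cylinder B).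
Proof. by exists m; exact: depends_on_cylinder. Qed.

Lemma clopen_coordinate j (a : A) : clopen_set [set x | x j = a].
Proof. by exists j.+1 => x y /prefixP /= xy <-; rewrite xy. Qed.

Lemma clopen_shift C : clopen_set C -> clopen_set (left_shift @^-1` C).
Proof.
move=> [m Cm]; exists m.+1 => x y /prefixP xy /=; apply: Cm; apply/prefixP.
by move=> j jm; exact: xy.
Qed.

Lemma cylinder_coordinates m (B : m.-tuple A) :
  cylinder B = \bigcap_(j in [set: 'I_m]) [set x | x j = tnth B j].
Proof.
apply/seteqP; split=> [x <- j _/=|x xB]; first by rewrite tnth_mktuple.
by apply: eq_from_tnth => j; rewrite tnth_mktuple xB.
Qed.

Lemma depends_on_prefixE m C : depends_on_prefix m C ->
  C = \bigcup_(B in [set B : m.-tuple A | exists2 x, C x & prefix m x = B])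
        cylinder B.
Proof.
move=> Cm; apply/seteqP; split=> [x Cx|x [_ [y Cy <-]] xy].
  by exists (prefix m x); first exists x.
exact: Cm Cy.
Qed.

(** The filter generated by the cylinders around [x] converges to [x] coordinate by coordinate,
    hence contains every neighbourhood of [x] in the product topology. *)
Lemma open_cylinder (O : set {ptws nat -> discrete_topology A}) x :
  open O -> O x -> exists m, forall y, prefix m x = prefix m y -> O y.
Proof.
move=> oO Ox; pose F := filter_from setT (fun m => [set y | prefix m x = prefix m y]).
have FF : Filter F.
  apply: filter_from_filter; first by exists 0%N.
  move=> m n _ _; exists (maxn m n) => // y /prefixP xy; split; apply/prefixP.
  - by move=> j jm; apply: xy; rewrite leq_max jm.
  - by move=> j jm; apply: xy; rewrite leq_max jm orbT.
have : F `=>` nbhs (x : {ptws nat -> discrete_topology A}).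
  apply/pointwise_cvgP => t V; rewrite /= nbhs_principalE /= => Vx.
  by exists t.+1 => // y /prefixP xy /=; apply: Vx; rewrite /= xy.
move=> /(_ O); case; first by apply: open_nbhs_nbhs; split.
by move=> m _ mO; exists m => y /mO.
Qed.

Lemma open_coordinate j (a : A) :
  open ([set x | x j = a] : set {ptws nat -> discrete_topology A}).
Proof.
rewrite (_ : [set x | _] = proj j @^-1` [set a])//.
by apply: open_comp; [move=> + _; exact: proj_continuous|exact: discrete_open].
Qed.

Lemma measurable_coordinate j (a : A) :
  measurable ([set x | x j = a] : set (seqspace A)).
Proof. by apply: sub_sigma_algebra; exact: open_coordinate. Qed.

Lemma measurable_cylinder m (B : m.-tuple A) : measurable (cylinder B).
Proof.
rewrite cylinder_coordinates; apply: fin_bigcap_measurable => // j _.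
exact: measurable_coordinate.
Qed.

Lemma measurable_depends_on_prefix m C : depends_on_prefix m C -> measurable C.
Proof.
move=> /depends_on_prefixE ->; apply: fin_bigcup_measurable => // B _.
exact: measurable_cylinder.
Qed.

Lemma measurable_clopen C : clopen_set C -> measurable C.
Proof. by move=> [m]; exact: measurable_depends_on_prefix. Qed.

(** An open set is the countable union over [m] of the sets of points whose whole [m]-cylinder lies
    in it, and these sets are clopen. *)
Lemma measurable_seqspaceE : @measurable _ (seqspace A) = <<s clopen_set >>.
Proof.
apply/seteqP; split.
  apply: smallest_sub; first exact: smallest_sigma_algebra.
  move=> O oO.
  have -> : O = \bigcup_(m in setT)
      [set x | forall y, prefix m x = prefix m y -> O y].
    apply/seteqP; split=> [x Ox|x [m _]]; last exact.
    by have [m mO] := open_cylinder oO Ox; exists m.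
  apply: sigma_algebra_bigcup => m; apply: sub_sigma_algebra.
  by exists m => x y xy /= xO z yz; apply: xO; rewrite xy.
apply: smallest_sub; first exact: sigma_algebra_measurable.
exact: measurable_clopen.
Qed.

Lemma measurable_fun_seqspace d (T : measurableType d) (f : T -> seqspace A) :
  (forall j a, measurable [set w | f w j = a]) -> measurable_fun setT f.
Proof.
move=> mf; apply: (@measurability _ _ _ _ _ _ clopen_set).
  exact: measurable_seqspaceE.
move=> _ [C [m Cm] <-].
rewrite setTI (depends_on_prefixE Cm) preimage_bigcup.
apply: fin_bigcup_measurable => // B _.
rewrite cylinder_coordinates preimage_bigcap.
by apply: fin_bigcap_measurable => // j _; exact: mf.
Qed.

Lemma measurable_left_shift :
  measurable_fun setT (@left_shift A : seqspace A -> seqspace A).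
Proof.
by apply: measurable_fun_seqspace => j a; exact: measurable_coordinate.
Qed.

End sequence_space.

Section uniqueness.
Context {A : finPointedType} {R : realType}.
Implicit Types mu nu : probability (seqspace A) R.

Lemma clopen_measureE mu m C : depends_on_prefix m C ->
  mu C = \sum_(B : m.-tuple A | `[< exists2 x, C x & prefix m x = B >])
           mu (cylinder B).
Proof.
move=> Cm; rewrite {1}(depends_on_prefixE Cm) measure_fin_bigcup//.
- rewrite [RHS]bigfs ?index_enum_uniq//; last by move=> B _; rewrite mem_index_enum.
  by apply: eq_fsbigl; apply/seteqP; split=> B /= /asboolP.
- exact: finite_finset.
- by move=> B B' _ _ [x [<- <-]].
- by move=> B _; exact: measurable_cylinder.
Qed.

(** Clopen sets are stable under intersection, include the whole space and generate the Borel
    sigma-algebra, so the uniqueness theorem for measures applies. *)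
Lemma eq_measure_clopen mu nu :
  (forall C, clopen_set C -> mu C = nu C) ->
  forall C, measurable C -> mu C = nu C.
Proof.
move=> munu; apply: (@measure_unique _ _ _ clopen_set (fun=> setT)) => //.
- exact: measurable_seqspaceE.
- exact: clopen_setI.
- by move=> _; exact: clopen_setT.
- by rewrite bigcup_const//; exists 0%N.
- by move=> _; rewrite (le_lt_trans (probability_le1 _ _)) ?ltry.
Qed.

Lemma eq_measure_cylinder mu nu :
  (forall m (B : m.-tuple A), (0 < m)%N -> mu (cylinder B) = nu (cylinder B)) ->
  forall C, measurable C -> mu C = nu C.
Proof.
(* Lengthening the prefix by one makes it nonempty, because the hypothesis covers only blocks of
   positive length. *)
move=> munu; apply: eq_measure_clopen => C [m /(depends_on_prefixW (leqnSn m)) Cm].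
by rewrite !(clopen_measureE _ Cm); apply: eq_bigr => B _; exact: munu.
Qed.

End uniqueness.

(** * The one-sided ergodic theorem *)

Lemma measurable_superlevel d (X : measurableType d) (R : realType)
    (f : X -> R) (a : R) :
  measurable_fun setT f -> measurable [set x | a < f x].
Proof.
move=> mf; rewrite -[X in measurable X]setTI.
rewrite (_ : [set x | _] = f @^-1` `]a, +oo[); first exact: mf.
by apply/seteqP; split=> x /=; rewrite in_itv/= andbT.
Qed.

Section bounded_integrals.
Context {d : measure_display} {X : measurableType d} {R : realType}.
Variable P : probability X R.
Implicit Types f : X -> R.

Lemma bounded_integrable f (M : R) :
  measurable_fun setT f -> (forall x, `|f x| <= M) ->
  P.-integrable setT (EFin \o f).
Proof.
move=> mf fM; apply: measurable_bounded_integrable => //.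
  by rewrite (le_lt_trans (probability_le1 _ _)) ?ltry.
exists M; split; first exact: num_real.
by move=> y My x _; exact: (le_trans (fM x) (ltW My)).
Qed.

Lemma Rintegral_invariant T f (M : R) : measurable_fun setT T ->
  measure_invariant T P -> measurable_fun setT f -> (forall x, `|f x| <= M) ->
  \int[P]_x f (T x) = \int[P]_x f x.
Proof.
move=> mT invT mf fM; rewrite /Rintegral; congr fine.
transitivity (\int[pushforward P T]_y (EFin \o f) y)%E.
  rewrite integral_pushforward//; first exact/measurable_EFinP.
  apply: (bounded_integrable (M := M)); first exact: measurableT_comp.
  by move=> x; exact: fM.
by apply: eq_measure_integral => C mC _; exact: invT.
Qed.

End bounded_integrals.

Section ergodic_averages.
Context {d : measure_display} {X : measurableType d} {R : realType}.
Variables (P : probability X R) (T : X -> X).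
Hypothesis mT : measurable_fun setT T.
Implicit Types (f g : X -> R).

Definition birkhoff_sum f n x : R := \sum_(i < n) f (iter i T x).

Lemma birkhoff_sumS f n x :
  birkhoff_sum f n.+1 x = f x + birkhoff_sum f n (T x).
Proof.
rewrite /birkhoff_sum big_ord_recl; congr (_ + _).
by apply: eq_bigr => i _; rewrite -iterSr.
Qed.

(** The maximum of the Birkhoff sums of orders [0] to [n]; in this recursive form the identity
    behind the maximal inequality follows by unfolding. *)
Fixpoint birkhoff_max f n x : R :=
  if n is m.+1 then Num.max 0 (f x + birkhoff_max f m (T x)) else 0.

Lemma birkhoff_max_ge0 f n x : 0 <= birkhoff_max f n x.
Proof. by case: n => //= n; rewrite le_max lexx. Qed.

Lemma birkhoff_max_nondecreasing f n x :
  birkhoff_max f n x <= birkhoff_max f n.+1 x.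
Proof.
elim: n x => [x|n IH x]; first exact: birkhoff_max_ge0.
rewrite [leRHS]/= ge_max !le_max lexx/=; apply/orP; right.
by rewrite lerD2l; exact: IH.
Qed.

Lemma birkhoff_sum_le_max f k n x :
  (k <= n)%N -> birkhoff_sum f k x <= birkhoff_max f n x.
Proof.
elim: n k x => [|n IH] [|k] x // kn;
  rewrite ?birkhoff_sumS ?[birkhoff_sum f 0 x]/birkhoff_sum ?big_ord0 //.
- exact: birkhoff_max_ge0.
- by rewrite /= le_max lerD2l IH ?orbT.
Qed.

Lemma measurable_birkhoff_sum f n :
  measurable_fun setT f -> measurable_fun setT (birkhoff_sum f n).
Proof.
move=> mf; apply: (@measurable_sum _ _ _ _ _ _ (fun (i : 'I_n) x => f (iter i T x))).
move=> i; apply: measurableT_comp => //.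
by elim: (nat_of_ord i) => [|k IH]; [exact: measurable_id|exact: measurableT_comp].
Qed.

Lemma measurable_birkhoff_max f n :
  measurable_fun setT f -> measurable_fun setT (birkhoff_max f n).
Proof.
move=> mf; elim: n => [|n IH]; first exact: measurable_cst.
apply: measurable_maxr; first exact: measurable_cst.
by apply: measurable_funD => //; exact: measurableT_comp.
Qed.

Lemma birkhoff_max_bound f (M : R) n x : (forall x, `|f x| <= M) ->
  `|birkhoff_max f n x| <= M *+ n.
Proof.
move=> fM; rewrite ger0_norm ?birkhoff_max_ge0//.
elim: n x => [|n IH] x //=; rewrite mulrS ge_max addr_ge0 ?lerD//=.
- by rewrite (le_trans (ler_norm _) (fM x)).
- by rewrite (le_trans (normr_ge0 _) (fM x)).
- by rewrite (le_trans (birkhoff_max_ge0 f n x) (IH x)).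
Qed.

Definition birkhoff_unbounded f : set X :=
  [set x | forall C : nat, exists n, C%:R < birkhoff_sum f n x].

Lemma birkhoff_unboundedP f x : birkhoff_unbounded f x <->
  forall C : R, exists n, C < birkhoff_sum f n x.
Proof.
split=> [fx C|fx C]; last exact: fx.
have [n /(le_lt_trans _) nS] := fx (Num.truncn `|C|).+1; exists n; apply: nS.
by rewrite (le_trans (ler_norm _))// ltW// truncnS_gt.
Qed.

(** Passing from [x] to [T x] drops the first term of each sum, which changes it by the fixed amount
    [f x]. Invariance is an equality of sets, as [ergodic_measure] requires. *)
Lemma preimage_birkhoff_unbounded f :
  T @^-1` birkhoff_unbounded f = birkhoff_unbounded f.
Proof.
apply/seteqP; split=> x /= /birkhoff_unboundedP fx; apply/birkhoff_unboundedP => C.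
- have [n nC] := fx (C - f x); exists n.+1.
  by rewrite birkhoff_sumS -ltrBlDl.
(* The maximum with [0] excludes the empty sum, so that a first term can be split off. *)
- have [[|n]] := fx (Num.max 0 (C + f x)).
    by rewrite /birkhoff_sum big_ord0 gt_max ltxx.
  rewrite birkhoff_sumS gt_max => /andP[_]; rewrite (addrC C) ltrD2l.
  by exists n.
Qed.

Definition birkhoff_exceeds f (C : nat) : set X :=
  [set x | exists n, C%:R < birkhoff_sum f n x].

Lemma measurable_birkhoff_exceeds f C :
  measurable_fun setT f -> measurable (birkhoff_exceeds f C).
Proof.
move=> mf; rewrite (_ : birkhoff_exceeds f C =
    \bigcup_n [set x | C%:R < birkhoff_sum f n x]); last first.
  by apply/seteqP; split=> x [n]; exists n.
apply: bigcup_measurable => n _.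
exact/measurable_superlevel/measurable_birkhoff_sum.
Qed.

Lemma birkhoff_unboundedE f :
  birkhoff_unbounded f = \bigcap_C birkhoff_exceeds f C.
Proof.
by apply/seteqP; split=> x xf C; [move=> _; exact: xf|have := xf C I].
Qed.

Lemma measurable_birkhoff_unbounded f :
  measurable_fun setT f -> measurable (birkhoff_unbounded f).
Proof.
move=> mf; rewrite birkhoff_unboundedE; apply: bigcap_measurable => //.
by move=> C _; exact: measurable_birkhoff_exceeds.
Qed.

(* With M_n the running maximum of the Birkhoff sums of f, the functions
   M_(n+1) - M_n o T = max (- M_n o T) f have nonnegative integral because T
   preserves P, and they converge to f wherever M_n is unbounded. *)
Lemma birkhoff_unbounded_integral_ge0 f (M : R) : measure_invariant T P ->
  measurable_fun setT f -> (forall x, `|f x| <= M) ->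
  P (birkhoff_unbounded f) = 1%E -> 0 <= \int[P]_x f x.
Proof.
move=> invT mf fM P1.
pose h n x := Num.max (- birkhoff_max f n (T x)) (f x).
have hE n x : h n x = birkhoff_max f n.+1 x - birkhoff_max f n (T x).
  by rewrite /h /= addr_maxl sub0r addrK.
have hM n x : `|h n x| <= M.
  rewrite ler_norml le_max ge_max.
  have /[!ler_norml]/andP[-> ->] := fM x.
  rewrite orbT andbT/= lerNl (le_trans _ (birkhoff_max_ge0 _ _ _))//.
  by rewrite lerNl oppr0 (le_trans (normr_ge0 _) (fM x)).
have mTmax n : measurable_fun setT (fun x => birkhoff_max f n (T x)).
  by apply: measurableT_comp => //; exact: measurable_birkhoff_max.
have mh n : measurable_fun setT (h n).
  by apply: measurable_maxr => //; exact: measurableT_comp.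
have h_ge0 n : 0 <= \int[P]_x h n x.
  under eq_Rintegral do rewrite hE.
  have iM k : P.-integrable setT (EFin \o birkhoff_max f k).
    apply: (@bounded_integrable _ _ _ _ _ (M *+ k)).
      exact: measurable_birkhoff_max.
    by move=> x; exact: birkhoff_max_bound.
  rewrite RintegralB//; last first.
    by apply: (@bounded_integrable _ _ _ _ _ (M *+ n)) => // x; exact: birkhoff_max_bound.
  rewrite (@Rintegral_invariant _ _ _ P T _ (M *+ n))//; last 2 first.
  - exact: measurable_birkhoff_max.
  - by move=> x; exact: birkhoff_max_bound.
  by rewrite subr_ge0; apply: le_Rintegral => // x _; exact: birkhoff_max_nondecreasing.
have cvgh : \forall x \ae P, setT x -> (h n x)%:E @[n --> \oo] --> (f x)%:E.
  exists (~` birkhoff_unbounded f); split.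
  - by apply: measurableC; exact: measurable_birkhoff_unbounded.
  - by rewrite probability_setC ?P1 ?subee//; exact: measurable_birkhoff_unbounded.
  apply: subsetC => x; rewrite -preimage_birkhoff_unbounded /= => /birkhoff_unboundedP fx _.
  (* Once the running maximum at [T x] exceeds [M], the value [h n x] is [f x], so the sequence is
     eventually constant. *)
  have [n0 n0M] := fx M.
  apply: cvg_near_cst; near=> n; rewrite /h; congr (_%:E); apply: max_r.
  have /[!ler_norml]/andP[fx' _] := fM x.
  rewrite (le_trans _ fx')// lerN2 (le_trans (ltW n0M))// birkhoff_sum_le_max//.
  by near: n; exact: nbhs_infty_ge.
have [_ _] := @dominated_convergence _ _ _ P setT measurableT
  (fun n x => (h n x)%:E) (fun x => (f x)%:E) (cst M%:E)
  (fun n => (measurable_EFinP _ _).2 (mh n)) ((measurable_EFinP _ _).2 mf) cvgh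
  (@finite_measure_integrable_cst _ _ _ P _ M measurableT)
  (aeW _ (fun x n _ => hM n x)).
move=> hf; have fin : (\int[P]_x (f x)%:E)%E \is a fin_num.
  by apply: integrable_fin_num => //; exact: (@bounded_integrable _ _ _ _ _ M).
rewrite -lee_fin fineK//; apply: cvge_ge hf; apply: nearW => n /=.
rewrite -(@fineK _ (\int[P]_x (h n x)%:E)%E) ?lee_fin//; first exact: h_ge0.
by apply: integrable_fin_num => //; exact: (@bounded_integrable _ _ _ _ _ M).
Unshelve. all: end_near. Qed.

(** The set where the sums are unbounded is invariant, so its measure is 0 or 1, and 1 would force a
    nonnegative integral. The claim is then continuity from above along the sets
    [birkhoff_exceeds f C]. *)
Lemma ergodic_birkhoff_bounded f (M : R) : ergodic_measure T P ->
  measurable_fun setT f -> (forall x, `|f x| <= M) -> \int[P]_x f x < 0 ->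
  (P \o birkhoff_exceeds f) C @[C --> \oo] --> 0%E.
Proof.
move=> [invT ergT] mf fM f0.
have [P0|P1] := ergT _ (measurable_birkhoff_unbounded mf)
  (preimage_birkhoff_unbounded f); last first.
  by have := birkhoff_unbounded_integral_ge0 invT mf fM P1; rewrite leNgt f0.
rewrite -P0 birkhoff_unboundedE; apply: nonincreasing_cvg_mu.
- by rewrite (le_lt_trans (probability_le1 _ _)) ?ltry//; exact: measurable_birkhoff_exceeds.
- by move=> C; exact: measurable_birkhoff_exceeds.
- by rewrite -birkhoff_unboundedE; exact: measurable_birkhoff_unbounded.
- move=> C D CD; apply/subsetPset => x [n Dn]; exists n.
  by rewrite (le_lt_trans _ Dn) ?ler_nat.
Qed.

(** The upper half of the ergodic theorem, in measure. Subtracting the mean plus [e / 2] gives a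
    function [g] of negative integral; an excess of [L * e] for [f] is an excess of [L * (e / 2)]
    for [g], which is rare once [L * (e / 2)] passes a suitable [C]. *)
Lemma ergodic_average_le f (M e h : R) : ergodic_measure T P ->
  measurable_fun setT f -> (forall x, `|f x| <= M) -> 0 < e -> 0 < h ->
  exists N : nat, forall L : nat, (N <= L)%N ->
    (P [set x | (L%:R * (\int[P]_x f x + e) < birkhoff_sum f L x)%R] < h%:E)%E.
Proof.
move=> ergT mf fM e0 h0; set a := \int[P]_x f x.
pose g x := f x - (a + e / 2).
have mg : measurable_fun setT g by exact: measurable_funB.
have gM x : `|g x| <= M + `|a + e / 2|.
  by rewrite (le_trans (ler_normB _ _))// lerD2r.
have g0 : \int[P]_x g x < 0.
  rewrite RintegralB//.
  - rewrite Rintegral_cst// [X in fine X](_ : _ = 1%E) /=; last exact: probability_setT.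
    rewrite mulr1 -/a opprD addrA subrr sub0r.
    by rewrite oppr_lt0 divr_gt0.
  - exact: (@bounded_integrable _ _ _ _ _ (M)).
  - by apply: (@bounded_integrable _ _ _ _ _ (`|a + e / 2|)).
have := ergodic_birkhoff_bounded ergT mg gM g0.
move=> /fine_cvgP[_ /cvgr_lt /(_ _ h0)] [C _ /(_ C (leqnn _))] /= PC.
pose N := Num.truncn (C%:R / (e / 2)); exists N.+1 => L NL.
have mf' : measurable [set x | L%:R * (a + e) < birkhoff_sum f L x].
  exact/measurable_superlevel/measurable_birkhoff_sum.
rewrite (le_lt_trans (y := P (birkhoff_exceeds g C)))//; last first.
  rewrite -(@fineK _ (P _)) ?lte_fin ?fin_num_measure//.
  exact: measurable_birkhoff_exceeds.
apply: le_measure; rewrite ?inE//; first exact: measurable_birkhoff_exceeds.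
move=> x /= fx; exists L.
have -> : birkhoff_sum g L x = birkhoff_sum f L x - L%:R * (a + e / 2).
  by rewrite /birkhoff_sum /g sumrB sumr_const card_ord mulr_natl.
have Ce : C%:R <= L%:R * (e / 2).
  rewrite -ler_pdivrMr ?divr_gt0// (le_trans (ltW (truncnS_gt _)))//.
  by rewrite ler_nat.
nra.
Qed.

End ergodic_averages.

(** * Invariant measures as limits of empirical averages *)

Section pushforward.
Context {d1 d2 : measure_display} {X : measurableType d1} {Y : measurableType d2}.
Context {R : realType}.

Lemma pushforward_probability (P : probability X R) (f : X -> Y) :
  measurable_fun setT f ->
  exists Q : probability Y R, forall C, Q C = P (f @^-1` C).
Proof.
move=> mf; pose mfm := isMeasurableFun.Build _ _ _ _ f mf.
pose F : {mfun X >-> Y} := HB.pack f mfm.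
by exists (distribution P F).
Qed.

End pushforward.

Section ultrafilter_limits.
Context {I : Type} {U : set_system I} {UU : UltraFilter U}.

(** The image of an ultrafilter is an ultrafilter, hence converges in a compact segment. All
    frequencies thus converge along one ultrafilter, before any subsequence is extracted. *)
Lemma ultrafilter_bounded_cvg (R : realType) (u : I -> R) (a b : R) :
  (forall i, a <= u i <= b) -> cvg (u i @[i --> U]).
Proof.
move=> uab; have uU : UltraFilter (u i @[i --> U]).
  split; first exact: fmap_proper_filter.
  move=> G PG UG; apply/seteqP; split=> // V GV.
  have [//|UVC] := in_ultra_setVsetC (u @^-1` V) UU.
  have : G (V `&` ~` V) by apply: filterI => //; exact: UG.
  by rewrite setICr => /filter_not_empty.
have := @segment_compact R a b; rewrite compact_ultra.
move=> /(_ _ uU)[]; first by apply: nearW => i /=; rewrite in_itv/=.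
by move=> l [_ ul]; apply/cvg_ex; exists l.
Qed.

Lemma ultrafilter_finite_constant (A : finType) (u : I -> A) :
  exists a, U [set i | u i = a].
Proof.
apply: contrapT => /forallNP nU.
have UC a : U (~` [set i | u i = a]).
  by have [/nU|] := in_ultra_setVsetC [set i | u i = a] UU.
have [i iC] := filter_ex (@filter_forall _ _ _ U _ UC).
exact: (iC (u i)).
Qed.

End ultrafilter_limits.

(** The tails of [S] generate a proper filter finer than [\oo], and any ultrafilter above it will
    do. *)
Lemma eventually_ultrafilter (S : set nat) :
  (forall N, exists2 n, (N <= n)%N & S n) ->
  exists2 U : set_system nat, UltraFilter U & (\oo `<=` U) /\ U S.
Proof.
move=> Sinf; pose F := filter_from setT (fun N => [set n | (N <= n)%N /\ S n]).
have PF : ProperFilter F.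
  apply: filter_from_proper; last first.
    by move=> N _; have [n Nn Sn] := Sinf N; exists n.
  apply: filter_from_filter; first by exists 0%N.
  move=> m n _ _; exists (maxn m n) => // k /= [].
  by rewrite geq_max => /andP[].
have [U [UU FU]] := ultraFilterLemma PF; exists U => //; split.
- by move=> V [N _ NV]; apply: FU; exists N => // n [/NV].
- by apply: FU; exists 0%N => // n [].
Qed.

Section compactness.
Context {A : finPointedType}.
Implicit Types (C : set (seqspace A)) (F : (set (seqspace A))^nat).

(** If no finite subfamily covers [C], choose [w N] in [C] outside the first [N] sets. The
    coordinatewise limit of [w] along a free ultrafilter agrees with some far [w n] on any given
    prefix, so it lies in [C] and in no [F i]. *)
Lemma clopen_compact C F : clopen_set C -> (forall n, clopen_set (F n)) ->
  C `<=` \bigcup_n F n -> exists N, C `<=` \big[setU/set0]_(i < N) F i.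
Proof.
move=> [m Cm] cF CF; apply: contrapT => /forallNP nC.
have /choice[w wP] : forall N, exists x, C x /\ forall i, (i < N)%N -> ~ F i x.
  move=> N; have /existsNP[x /not_implyP[Cx Fx]] := nC N; exists x; split=> //.
  by move=> i iN Fix; apply: Fx; rewrite -bigcup_mkord; exists i.
have [U UU [ooU _]] := @eventually_ultrafilter setT (fun N => ex_intro2 _ _ N (leqnn N) I).
have /choice[x xP] : forall j, exists a, U [set n | w n j = a].
  by move=> j; exact: ultrafilter_finite_constant.
have xU k : U [set n | prefix k (w n) = prefix k x].
  have wx : U [set n | forall j : 'I_k, w n j = x j].
    exact: (@filter_forall _ 'I_k (fun j => [set n | w n j = x j]) U _ (fun j => xP j)).
  by apply: filterS wx => n nx; apply/prefixP => j jk; exact: (nx (Ordinal jk)).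
have Cx : C x.
  have [n nx] := filter_ex (xU m).
  exact: (Cm _ _ nx (proj1 (wP n))).
have [i _ Fix] := CF _ Cx; have [k Fk] := cF i.
have Ui : U [set n | (i < n)%N] by apply: ooU; exists i.+1.
have [n [nx /= ni]] := filter_ex (filterI (xU k) Ui).
exact: ((wP n).2 _ ni (Fk _ _ (esym nx) Fix)).
Qed.

End compactness.

(** A copy of the sequence space that carries the algebra of clopen sets in place of the Borel
    sigma-algebra, as the starting point of the Caratheodory extension. *)
Definition clopen_algebra (A : finPointedType) : Type := seqspace A.

Fact clopen_display : measure_display. Proof. exact. Qed.

HB.instance Definition _ (A : finPointedType) := Pointed.on (clopen_algebra A).
HB.instance Definition _ (A : finPointedType) :=
  @isAlgebraOfSets.Build clopen_display (clopen_algebra A) clopen_set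
    clopen_set0 clopen_setU clopen_setC.

Section extension.
Context {A : finPointedType} {R : realType}.

(* By compactness a finitely additive set function on clopen sets is
   automatically countably subadditive. *)
Lemma clopen_content_extension (m : set (seqspace A) -> R) :
  (forall C, 0 <= m C) -> m setT = 1 ->
  (forall C D, clopen_set C -> clopen_set D -> C `&` D = set0 ->
    m (C `|` D) = m C + m D) ->
  exists P : probability (seqspace A) R,
    forall C, clopen_set C -> P C = (m C)%:E.
Proof.
move=> m_ge0 mT mU.
pose c (C : set (clopen_algebra A)) : \bar R := (m C)%:E.
have c0 : c set0 = 0%E.
  have := mU _ _ clopen_set0 clopen_set0 (setI0 _).
  by rewrite setU0 /c => /eqP; rewrite -subr_eq0 opprD addrA subrr sub0r oppr_eq0 => /eqP ->.
have c_add : measure_function.semi_additive c.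
  apply/additive2P => // C D mC mD CD.
  by rewrite /c mU.
have c_ge0 C : (0 <= c C)%E by rewrite lee_fin.
pose cc := isContent.Build _ _ R c c_ge0 c_add.
pose cont : {content set (clopen_algebra A) -> \bar R} := HB.pack c cc.
have c_sub : measurable_subset_sigma_subadditive cont.
  move=> C F mF mC CF; have [N CN] := clopen_compact mC mF CF.
  apply: (le_trans (y := (\sum_(i < N) cont (F i))%E)).
    exact: content_subadditive.
  by rewrite -(big_mkord xpredT (cont \o F)); exact: nneseries_lim_ge.
pose cm := Content_SigmaSubAdditive_isMeasure.Build _ _ _ cont c_sub.
pose mu : measure (clopen_algebra A) R := HB.pack (Content.sort cont) cm.
pose P : set (seqspace A) -> \bar R := measure_extension mu.
have P_clopen C : clopen_set C -> P C = (m C)%:E.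
  by move=> mC; rewrite /P /measure_extension measurable_mu_extE.
have P0 : P set0 = 0%E by rewrite P_clopen//; exact: clopen_set0.
have P_ge0 C : (0 <= P C)%E by exact: (measure_ge0 (measure_extension mu)).
have P_add : semi_sigma_additive P.
  move=> F mF tF mUF.
  apply: (@measure_semi_sigma_additive _ _ _ (measure_extension mu)) => //.
  - by move=> i; have := mF i; rewrite measurable_seqspaceE.
  - by move: mUF; rewrite measurable_seqspaceE.
have PT : P setT = 1%E by rewrite P_clopen ?mT//; exact: clopen_setT.
pose Pm := isMeasure.Build _ _ _ P P0 P_ge0 P_add.
pose Pm' : measure (seqspace A) R := HB.pack P Pm.
pose Pp := Measure_isProbability.Build _ _ _ Pm' PT.
pose Q : probability (seqspace A) R := HB.pack (Measure.sort Pm') Pp.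
by exists Q.
Qed.

End extension.

Section empirical_averages.
Context {A : finPointedType} {R : realType}.
Implicit Types (x z : seqspace A) (C : set (seqspace A)).

Definition average (g : seqspace A -> R) n z : R :=
  n%:R^-1 * birkhoff_sum left_shift g n z.

Lemma iter_left_shift n x : iter n left_shift x = (fun j => x (n + j)%N).
Proof.
elim: n => //= n ->; apply/funext => j; rewrite /left_shift.
by rewrite addSnnS.
Qed.

Lemma block_freqE m (B : m.-tuple A) n x :
  block_freq x B n = average \1_(cylinder B) n x.
Proof.
rewrite /block_freq /average /birkhoff_sum mulrC -sum1_card natr_sum.
rewrite big_mkcond/=; congr (_ * _); apply: eq_bigr => i _.
rewrite indicE iter_left_shift inE/=; case: eqP => iB; first by rewrite mem_set.
by rewrite memNset.
Qed.

Lemma average_ge0 g n z : (forall x, 0 <= g x) -> 0 <= average g n z.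
Proof. by move=> g0; rewrite mulr_ge0 ?invr_ge0// sumr_ge0. Qed.

Lemma averageD g h n z :
  average (fun x => g x + h x) n z = average g n z + average h n z.
Proof. by rewrite /average /birkhoff_sum big_split mulrDr. Qed.

Lemma average_cst (a : R) n z : average (fun=> a) n.+1 z = a.
Proof.
by rewrite /average /birkhoff_sum sumr_const card_ord -[a *+ _]mulr_natl mulrA mulVf// mul1r.
Qed.

Lemma average_indic_le1 C n z : average \1_C n.+1 z <= 1.
Proof.
rewrite -[leRHS](average_cst 1 n z) ler_pM2l ?invr_gt0 ?ltr0n//.
by apply: ler_sum => i _; rewrite indicE lern1 leq_b1.
Qed.

(** The sum telescopes. The right-hand side vanishes in the limit for bounded [g], which makes
    limits of averages shift-invariant. *)
Lemma average_shift g n z :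
  average (g \o left_shift) n z - average g n z =
  n%:R^-1 * (g (iter n left_shift z) - g z).
Proof.
rewrite /average -mulrBr; congr (_ * _).
elim: n => [|n IH]; first by rewrite /birkhoff_sum !big_ord0 subrr subrr.
rewrite /birkhoff_sum !big_ord_recr/= -!/(birkhoff_sum _ _ _ _) opprD addrACA IH.
by rewrite -iterS; ring.
Qed.

End empirical_averages.

Section limit_measure.
Context {A : finPointedType} {R : realType}.

(** The limits along [U] of the frequencies form a finitely additive content on clopen sets, which
    extends to a measure. It agrees with its image under the shift on clopen sets, since shifting
    changes an average by at most [n.+1%:R^-1]. *)
Lemma empirical_limit_measure (z : seqspace A) (U : set_system nat) :
    UltraFilter U -> \oo `<=` U ->
  exists P : probability (seqspace A) R, measure_invariant left_shift P /\
    forall C, clopen_set C -> average \1_C n.+1 z @[n --> U] --> fine (P C).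
Proof.
move=> UU ooU; pose m C : R := lim (average \1_C n.+1 z @[n --> U]).
have m_cvg C : average \1_C n.+1 z @[n --> U] --> m C.
  apply: (@ultrafilter_bounded_cvg _ _ _ R _ 0 1) => n.
  by rewrite average_indic_le1 average_ge0// => x; rewrite indicE.
have m_ge0 C : 0 <= m C.
  apply: limr_ge; first exact: m_cvg.
  by apply: nearW => n; rewrite average_ge0// => x; rewrite indicE.
have mT : m setT = 1.
  apply: cvg_lim => //; rewrite indicT.
  by under eq_fun do rewrite average_cst; exact: cvg_cst.
have mU C D : clopen_set C -> clopen_set D -> C `&` D = set0 ->
    m (C `|` D) = m C + m D.
  move=> _ _ CD; apply: cvg_lim => //.
  have -> : (fun n => average (\1_(C `|` D) : _ -> R) n.+1 z) =
      (fun n => average \1_C n.+1 z + average \1_D n.+1 z).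
    apply/funext => n; rewrite -averageD; congr (average _ _ _); apply/funext => x.
    have : ~~ ((x \in C) && (x \in D)) by rewrite -in_setI CD in_set0.
    rewrite !indicE in_setU.
    by case: (x \in C); case: (x \in D) => //= _; rewrite ?addr0 ?add0r.
  exact: cvgD (m_cvg C) (m_cvg D).
have [P PC] := clopen_content_extension m_ge0 mT mU.
exists P; split; last by move=> C cC; rewrite PC.
have [Q QP] := pushforward_probability P measurable_left_shift.
move=> C mC; rewrite -QP; apply: eq_measure_clopen C mC => C cC.
rewrite QP !PC//; last exact: clopen_shift.
congr (_%:E); apply: cvg_lim => //.
have -> : (fun n => average (\1_(left_shift @^-1` C) : _ -> R) n.+1 z) =
  (fun n => average \1_C n.+1 z +
     n.+1%:R^-1 * (\1_C (iter n.+1 left_shift z) - \1_C z)).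
  by apply/funext => n; rewrite -average_shift addrC subrK.
rewrite -[m C]addr0; apply: cvgD => //.
have : n.+1%:R^-1 * (\1_C (iter n.+1 left_shift z) - \1_C z) @[n --> \oo] --> (0 : R).
  apply/norm_cvg0P; apply: (@squeeze_cvgr _ \oo _ R (cst 0) (@harmonic R)); last 2 first.
  - exact: cvg_cst.
  - exact: cvg_harmonic.
  apply: nearW => n; rewrite normr_ge0 normrM ger0_norm ?invr_ge0//.
  rewrite ler_piMr ?invr_ge0// !indicE.
  by do 2!case: (_ \in _); rewrite /= ?subrr ?subr0 ?sub0r ?normrN ?normr0 ?normr1.
by apply: cvg_trans => V; exact: ooU.
Qed.

(** A diagonal choice: the term of rank [k] lies beyond the previous one and brings the quantities
    with code below [k] within [k.+1%:R^-1] of their limits. It turns limits along [U] into limits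
    along an honest subsequence. *)
Lemma common_subsequence (I : countType) (U : set_system nat)
    (u : I -> nat -> R) (a : I -> R) : ProperFilter U -> \oo `<=` U ->
  (forall i, u i n @[n --> U] --> a i) ->
  exists nk : nat -> nat, {homo nk : i j / (i < j)%N} /\
    forall i, u i (nk k) @[k --> \oo] --> a i.
Proof.
move=> PU ooU ua.
have /choice[next nextP] : forall kN : nat * nat, exists n,
    (kN.2 < n)%N /\ forall i, (choice.pickle i < kN.1)%N -> `|a i - u i n| < kN.1.+1%:R^-1.
  move=> [k N] /=.
  have UN : U [set n | (N < n)%N] by apply: ooU; exists N.+1.
  (* Quantifying over codes below [k] makes this a finite intersection of members of [U]; a number
     that codes no index imposes nothing. *)
  have H (j : 'I_k) : \forall n \near U, forall i, choice.pickle i = j ->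
      `|a i - u i n| < k.+1%:R^-1.
    case E : (@choice.unpickle I j) => [i|]; last first.
      by apply: nearW => n i ij; move: E; rewrite -ij choice.pickleK.
    have k0 : 0 < k.+1%:R^-1 :> R by rewrite invr_gt0 ltr0n.
    have /cvgrPdist_lt /(_ _ k0) := ua i; apply: filterS => n h i' ij.
    by move: E; rewrite -ij choice.pickleK => -[->].
  have [n [Nn nH]] := filter_ex (filterI UN (@filter_forall _ _ _ U _ H)).
  by exists n; split=> // i ik; exact: (nH (Ordinal ik)).
pose nk := fix nk k := if k is k'.+1 then next (k, nk k') else next (0%N, 0%N).
exists nk; split.
  by apply: homo_ltn => [|k]; [exact: ltn_trans|exact: (nextP (k.+1, nk k)).1].
move=> i; apply/cvgrPdist_lt => e e0.
near=> k.
have ik : (choice.pickle i < k)%N by near: k; exists (choice.pickle i).+1.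
have : k.+1%:R^-1 < e.
  rewrite invf_plt ?posrE//; near: k; exists (Num.truncn e^-1).+1 => // k /= ek.
  by rewrite (lt_le_trans (truncnS_gt _))// ler_nat; exact: leqW.
apply: lt_trans; have [k' kE] : exists k', k = k'.+1 by exists k.-1; lia.
rewrite kE in ik *; exact: (nextP (k'.+1, nk k')).2.
Unshelve. all: end_near. Qed.

End limit_measure.

(** * Integrals of finitely valued functions and of Birkhoff sums *)

Section finite_integrals.
Context {d : measure_display} {X : measurableType d} {R : realType}.
Variable P : probability X R.

Lemma Rintegral_sum (I : Type) (s : seq I) (h : I -> X -> R) :
  (forall i, P.-integrable setT (EFin \o h i)) ->
  \int[P]_x (\sum_(i <- s) h i x) = \sum_(i <- s) \int[P]_x h i x.
Proof.
move=> ih; elim: s => [|i s IH].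
  rewrite big_nil; under eq_Rintegral do rewrite big_nil.
  by rewrite Rintegral_cst// mul0r.
under eq_Rintegral do rewrite big_cons.
rewrite big_cons RintegralD//; first by rewrite IH.
rewrite (_ : _ \o _ = fun x => (\sum_(j <- s) (EFin \o h j) x)%E).
  exact: integrable_sum.
by apply/funext => x /=; rewrite sumEFin.
Qed.

Lemma Rintegral_indic C : measurable C -> \int[P]_x \1_C x = fine (P C).
Proof.
move=> mC; rewrite /Rintegral; congr fine.
rewrite -[in RHS](setIT C) -integral_indic//.
Qed.

Section finite_valued.
Context {T : finType}.
Variables (f : X -> T) (g : T -> R).
Hypothesis mf : forall t, measurable (f @^-1` [set t]).

Let finite_valuedE x : g (f x) = \sum_t g t * \1_(f @^-1` [set t]) x.
Proof.
rewrite (bigD1 (f x))//= indicE mem_set// mulr1 big1 ?addr0// => t tfx.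
by rewrite indicE memNset ?mulr0// => /= /esym/eqP; rewrite (negbTE tfx).
Qed.

Lemma measurable_finite_valued : measurable_fun setT (fun x => g (f x)).
Proof.
rewrite (_ : (fun x => _) = fun x => \sum_t g t * \1_(f @^-1` [set t]) x); last first.
  exact/funext.
apply: (@measurable_sum _ _ _ _ _ _ (fun t x => g t * \1_(f @^-1` [set t]) x)) => t.
by apply: measurable_funM => //; exact: measurable_indic.
Qed.

Lemma integrable_finite_valued : P.-integrable setT (EFin \o (fun x => g (f x))).
Proof.
apply: (@bounded_integrable _ _ _ _ _ (\sum_t `|g t|)).
  exact: measurable_finite_valued.
by move=> x; rewrite (bigD1 (f x))//= lerDl sumr_ge0.
Qed.

Lemma Rintegral_finite_valued :
  \int[P]_x g (f x) = \sum_t g t * fine (P (f @^-1` [set t])).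
Proof.
under eq_Rintegral do rewrite finite_valuedE.
have mt t : measurable_fun setT (\1_(f @^-1` [set t]) : X -> R).
  exact: measurable_indic.
have it t : P.-integrable setT (EFin \o (\1_(f @^-1` [set t]) : X -> R)).
  by apply: (@bounded_integrable _ _ _ _ _ 1) => // x; rewrite indicE; case: (_ \in _); rewrite ?normr1 ?normr0.
rewrite Rintegral_sum; last first.
  move=> t; apply: (@bounded_integrable _ _ _ _ _ `|g t|).
    exact: measurable_funM.
  by move=> x; rewrite indicE; case: (_ \in _); rewrite ?mulr1 ?mulr0 ?normr0.
by apply: eq_bigr => t _; rewrite RintegralZl// Rintegral_indic.
Qed.

End finite_valued.

Lemma Rintegral_birkhoff_sum (T : X -> X) (g : X -> R) (M : R) L :
  measurable_fun setT T -> measure_invariant T P -> measurable_fun setT g ->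
  (forall x, `|g x| <= M) ->
  \int[P]_x birkhoff_sum T g L x = L%:R * \int[P]_x g x.
Proof.
move=> mT invT mg gM.
have bM n x : `|birkhoff_sum T g n x| <= M *+ n.
  rewrite (le_trans (ler_norm_sum _ _ _))// -[n in M *+ n]card_ord -sumr_const.
  by apply: ler_sum => i _; exact: gM.
elim: L => [|L IH].
  rewrite mul0r; under eq_Rintegral do rewrite /birkhoff_sum big_ord0.
  by rewrite Rintegral_cst// mul0r.
under eq_Rintegral do rewrite birkhoff_sumS.
rewrite RintegralD//.
- rewrite (@Rintegral_invariant _ _ _ P T _ (M *+ L))//.
    by rewrite IH mulrSr mulrDl mul1r addrC.
  exact: measurable_birkhoff_sum.
- exact: (@bounded_integrable _ _ _ _ _ M).
- apply: (@bounded_integrable _ _ _ _ _ (M *+ L)) => //.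
  by apply: measurableT_comp => //; exact: measurable_birkhoff_sum.
Qed.

End finite_integrals.

(** * Recoding a sequence block by block *)

Lemma sum_nat_addl (V : nmodType) (F : nat -> V) p L :
  \sum_(p <= i < p + L) F i = \sum_(j < L) F (p + j)%N.
Proof.
rewrite -{1}[p]add0n big_addn addKn big_mkord.
by apply: eq_bigr => j _; rewrite addnC.
Qed.

Section occurrences.
Context {A : finPointedType} {R : realType}.
Implicit Types (w z : seqspace A) (C : set (seqspace A)).

Definition occurrences C w s n : R :=
  \sum_(s <= i < n) \1_C (iter i left_shift w).

Lemma indic_le1 C w : (\1_C w : R) <= 1.
Proof. by rewrite indicE lern1 leq_b1. Qed.

Lemma indic_ge0 C w : 0 <= (\1_C w : R).
Proof. by rewrite indicE. Qed.

Lemma occurrences_ge0 C w s n : 0 <= occurrences C w s n.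
Proof. by apply: sumr_ge0 => i _; exact: indic_ge0. Qed.

Lemma occurrences_le C w s n : occurrences C w s n <= (n - s)%:R.
Proof.
rewrite -[(n - s)%N in leRHS]muln1 -sum_nat_const_nat natr_sum.
by apply: ler_sum => i _; exact: indic_le1.
Qed.

Lemma occurrences_cat C w s m n : (s <= m)%N -> (m <= n)%N ->
  occurrences C w s n = occurrences C w s m + occurrences C w m n.
Proof. by move=> sm mn; rewrite /occurrences (big_cat_nat (n := m)). Qed.

Lemma occurrences_shift C w p L : occurrences C w p (p + L) =
  birkhoff_sum left_shift \1_C L (iter p left_shift w).
Proof.
rewrite /occurrences sum_nat_addl; apply: eq_bigr => i _.
by rewrite addnC iterD.
Qed.

(** An occurrence starting before [n - D] reads only coordinates in the window, where [w] and [z]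
    agree; at most [D] starting positions remain. *)
Lemma occurrences_agree D C w z s n : depends_on_prefix D C ->
  (forall i, (s <= i < n)%N -> w i = z i) ->
  occurrences C w s n <= occurrences C z s n + D%:R.
Proof.
move=> CD wz; have [sn|ns] := leqP n (s + D).
  apply: (le_trans (occurrences_le _ _ _ _)); apply: (@le_trans _ _ D%:R).
    by rewrite ler_nat; lia.
  by rewrite lerDr occurrences_ge0.
have sn : (s <= n - D)%N by lia.
rewrite !(@occurrences_cat _ _ s (n - D) n) ?leq_subr// -addrA.
apply: lerD; last first.
  apply: (le_trans (occurrences_le _ _ _ _)); apply: (@le_trans _ _ D%:R).
    by rewrite ler_nat; lia.
  by rewrite lerDr occurrences_ge0.
rewrite /occurrences le_eqVlt; apply/orP; left; apply/eqP.
apply: eq_big_nat => i iD; rewrite !indicE; congr (_%:R); congr nat_of_bool.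
have E : prefix D (iter i left_shift w) = prefix D (iter i left_shift z).
  by apply/prefixP => j jD; rewrite !iter_left_shift; apply: wz; lia.
by apply/idP/idP; rewrite !inE; apply: CD; rewrite E.
Qed.

End occurrences.

Section block_code.
Context {A : finPointedType} {R : realType}.
Variables (x : seqspace A) (L : nat) (best : L.-tuple A -> seqspace A).
Hypothesis L_gt0 : (0 < L)%N.

Definition block s : L.-tuple A := prefix L (iter s left_shift x).

(* Cut x from position r on into consecutive blocks of length L, and replace
   each block u by the first L symbols of best u. *)
Definition block_code r : seqspace A := fun i =>
  if (i < r)%N then point
  else best (block (r + (i - r) %/ L * L)) ((i - r) %% L)%N.

Lemma block_codeE r q j : (j < L)%N ->
  block_code r (r + q * L + j)%N = best (block (r + q * L)) j.
Proof.
move=> jL; rewrite /block_code ltnNge -addnA leq_addr/= addKn.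
by rewrite divnMDl// divn_small// addn0 modnMDl modn_small.
Qed.

Section objective.
Variable psi : A -> A -> R.
Hypothesis psi_ge0 : forall a b, 0 <= psi a b.

Definition block_sum (u v : L.-tuple A) : R :=
  \sum_(j < L) psi (tnth u j) (tnth v j).

Definition best_sum u : R := block_sum u (prefix L (best u)).

Lemma block_code_sum r Q :
  \sum_(q < Q) best_sum (block (r + q * L)) <=
  \sum_(0 <= i < r + Q * L) psi (x i) (block_code r i).
Proof.
elim: Q => [|Q IH]; first by rewrite big_ord0 sumr_ge0.
rewrite big_ord_recr/= (big_cat_nat (n := (r + Q * L)%N))//=; last first.
  by rewrite leq_add2l mulSn leq_addl.
apply: lerD => //; rewrite mulSn (addnC L) addnA sum_nat_addl.
rewrite le_eqVlt; apply/orP; left; apply/eqP.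
apply: eq_bigr => j _; rewrite block_codeE// !tnth_mktuple.
by rewrite iter_left_shift.
Qed.

(** Each position below [Q * L] has a unique form [r + q * L], so the grids of block starts for the
    [L] offsets together exhaust all positions. *)
Lemma sum_offsets (F : nat -> R) Q :
  \sum_(r < L) \sum_(q < Q) F (r + q * L)%N = \sum_(0 <= s < Q * L) F s.
Proof.
rewrite exchange_big/=; elim: Q => [|Q IH]; first by rewrite big_ord0 big_geq.
rewrite big_ord_recr/= IH mulSn (addnC L) [RHS](big_cat_nat (n := (Q * L)%N))//=; last first.
  exact: leq_addr.
by congr (_ + _); rewrite sum_nat_addl; apply: eq_bigr => r _; rewrite addnC.
Qed.

Variable M : R.
Hypothesis psi_le : forall a b, psi a b <= M.

Lemma block_sum_ge0 u v : 0 <= block_sum u v.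
Proof. exact: sumr_ge0. Qed.

Lemma block_sum_le u v : block_sum u v <= L%:R * M.
Proof.
rewrite mulr_natl -[L in leRHS]card_ord -sumr_const.
by apply: ler_sum => i _.
Qed.

(** By averaging: summed over all offsets, the objective is at least the sum of [best_sum] over all
    starting positions, except for fewer than [2 * L] positions near [n], each worth at most
    [L%:R * M]. Some offset does at least as well as the mean. *)
Lemma exists_offset n : (L <= n)%N -> exists r : 'I_L,
  \sum_(0 <= s < n) best_sum (block s) - (2 * L)%:R * (L%:R * M) <=
  L%:R * \sum_(0 <= i < n) psi (x i) (block_code r i).
Proof.
move=> Ln; apply: contrapT => /forallNP H.
(* One block is given up so that [Q] full blocks fit below [n] for every offset [r < L]. *)
pose Q := (n %/ L).-1.
have nL : (0 < n %/ L)%N by rewrite divn_gt0.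
have QL : (Q * L + L <= n)%N.
  by rewrite addnC -mulSn /Q prednK// leq_trunc_div.
have nQ : (n < Q * L + 2 * L)%N.
  have := divn_eq n L; have := ltn_pmod n L_gt0; rewrite /Q.
  move: nL; case: (n %/ L)%N => // q _ /=; lia.
have QLn : (Q * L <= n)%N by lia.
have : \sum_(r < L) \sum_(0 <= i < n) psi (x i) (block_code r i) <
    \sum_(0 <= s < n) best_sum (block s) - (2 * L)%:R * (L%:R * M).
  set c := ltRHS; have cE : L%:R * c = \sum_(r < L) c.
    by rewrite sumr_const card_ord mulr_natl.
  rewrite -(ltr_pM2l (x := L%:R)) ?ltr0n// cE mulr_sumr.
  apply: ltr_sum => [|r _]; last by rewrite ltNge; apply/negP; exact: H.
  by apply/hasP; exists (Ordinal L_gt0) => //; rewrite mem_index_enum.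
apply/negP; rewrite -leNgt.
apply: (@le_trans _ _ (\sum_(0 <= s < Q * L) best_sum (block s))).
  rewrite lerBlDr (big_cat_nat (n := (Q * L)%N))//= lerD2l.
  apply: (@le_trans _ _ (\sum_(Q * L <= s < n) L%:R * M)).
    by apply: ler_sum => s _; exact: block_sum_le.
  rewrite sumr_const_nat -[_ *+ (n - _)]mulr_natl ler_wpM2r ?ler_nat//; last by lia.
  (* The constant block is an arbitrary witness that [L%:R * M] is nonnegative. *)
  exact: le_trans (block_sum_ge0 [tuple point | _ < L] [tuple point | _ < L]) (block_sum_le _ _).
rewrite -sum_offsets; apply: ler_sum => r _.
apply: (le_trans (block_code_sum r Q)).
have rn : (r + Q * L <= n)%N by have := ltn_ord r; lia.
by rewrite [leRHS](big_cat_nat (n := (r + Q * L)%N))//= lerDl sumr_ge0.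
Qed.

End objective.

Section frequency.
Variables (C : set (seqspace A)) (D : nat) (b : R).
Hypothesis CD : depends_on_prefix D C.
Hypothesis b_ge0 : 0 <= b.
Hypothesis best_occ :
  forall u, birkhoff_sum left_shift \1_C L (best u) + D%:R <= L%:R * b.

(** Inside the block the code copies [best]; the occurrences that read past its right end number at
    most [D], which is the slack in [best_occ]. *)
Lemma block_occurrences r q : occurrences C (block_code r) (r + q * L)
  (r + q * L + L) <= L%:R * b :> R.
Proof.
set p := (r + q * L)%N; apply: le_trans (best_occ (block p)).
(* The chosen sequence translated to start at [p], so that both sequences agree on the window. *)
pose z : seqspace A := fun i => best (block p) (i - p)%N.
have -> : birkhoff_sum left_shift \1_C L (best (block p)) =
    occurrences C z p (p + L) :> R.
  rewrite occurrences_shift iter_left_shift; congr birkhoff_sum.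
  by apply/funext => i; rewrite /z addKn.
apply: occurrences_agree => // i ip; rewrite /z.
have [j jL ->] : exists2 j, (j < L)%N & i = (p + j)%N.
  by exists (i - p)%N; lia.
by rewrite addKn block_codeE.
Qed.

(** The window splits into full blocks, controlled by [block_occurrences], and a piece of length at
    most [L] at each end, where every position is counted. The error does not grow with the
    window. *)
Lemma block_code_occurrences r s n : (r < L)%N -> (s <= n)%N ->
  occurrences C (block_code r) s n <= (n - s)%:R * b + (2 * L)%:R :> R.
Proof.
move=> rL sn.
(* A block boundary at most [L] places after [s]. *)
have [q [sp psL]] : exists q, (s <= r + q * L)%N /\ (r + q * L <= s + L)%N.
  have [sr|rs] := leqP s r; first by exists 0%N; lia.
  exists ((s - r) %/ L).+1; have := divn_eq (s - r) L.
  have := ltn_pmod (s - r) L_gt0; lia.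
set p := (r + q * L)%N in sp psL.
have [np|pn] := leqP n p.
  apply: (le_trans (occurrences_le _ _ _ _)).
  apply: (@le_trans _ _ (2 * L)%:R); first by rewrite ler_nat; lia.
  by rewrite lerDr mulr_ge0.
pose Q := ((n - p) %/ L)%N.
have nQ : (p + Q * L <= n)%N by have := leq_trunc_div (n - p) L; rewrite -/Q; lia.
have Qn : (n - (p + Q * L) <= L)%N.
  by have := divn_eq (n - p) L; have := ltn_pmod (n - p) L_gt0; rewrite -/Q; lia.
have occQ k : occurrences C (block_code r) p (p + k * L) <= (k * L)%:R * b :> R.
  elim: k => [|k IH]; first by rewrite mul0n addn0 /occurrences big_geq// mul0r.
  rewrite (@occurrences_cat _ _ _ _ _ (p + k * L)%N) ?leq_addr//; last by lia.
  rewrite mulSn natrD mulrDl addrC lerD//.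
  rewrite (_ : p + (L + k * L) = r + (q + k) * L + L)%N; last by rewrite /p; lia.
  rewrite (_ : p + k * L = r + (q + k) * L)%N; last by rewrite /p; lia.
  exact: block_occurrences.
rewrite (@occurrences_cat _ _ _ _ s p n)//; last by lia.
rewrite (@occurrences_cat _ _ _ _ p (p + Q * L)%N n)//; last by lia.
have h1 : occurrences C (block_code r) s p <= L%:R :> R.
  by rewrite (le_trans (occurrences_le _ _ _ _))// ler_nat; lia.
have h3 : occurrences C (block_code r) (p + Q * L) n <= L%:R :> R.
  by rewrite (le_trans (occurrences_le _ _ _ _))// ler_nat; lia.
have h2 : (Q * L)%:R * b <= (n - s)%:R * b.
  by rewrite ler_wpM2r// ler_nat; lia.
have := occQ Q; rewrite natrM; lra.
Qed.

End frequency.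
End block_code.

Lemma cvg_sumr (R : realType) T (F : set_system T) (I : Type) (r : seq I)
    (u : I -> T -> R) (l : I -> R) : Filter F ->
  (forall i, u i x @[x --> F] --> l i) ->
  \sum_(i <- r) u i x @[x --> F] --> \sum_(i <- r) l i.
Proof. by move=> FF ul; apply: cvg_big => //; exact: add_continuous. Qed.

(** Only finitely many [L]-prefixes occur in [G], so a maximum is attained. A whole sequence of [G]
    is returned, because counting patterns in a block reads beyond its end. *)
Lemma exists_best_block {A : finPointedType} {R : realType} (psi : A -> A -> R)
    L (G : set (seqspace A)) : G !=set0 ->
  exists best : L.-tuple A -> seqspace A, forall u, G (best u) /\
    forall z, G z -> block_sum psi u (prefix L z) <= best_sum best psi u.
Proof.
move=> [z0 Gz0].
suff /choice[best bestP] : forall u : L.-tuple A, exists b, G b /\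
    forall z, G z -> block_sum psi u (prefix L z) <= block_sum psi u (prefix L b).
  by exists best.
move=> u.
pose P v := `[< exists2 z, G z & prefix L z = v >].
have Pz0 : P (prefix L z0) by apply/asboolP; exists z0.
case: (@Order.TotalTheory.arg_maxP _ _ _ _ P (block_sum psi u) Pz0) => v /asboolP[z Gz zv] vmax.
exists z; split=> // z' Gz'; rewrite zv; apply: vmax.
by apply/asboolP; exists z'.
Qed.

Section first_symbols.
Context {A : finPointedType}.

Definition first_symbols (z : seqspace A * seqspace A) : A * A :=
  (z.1 0%N, z.2 0%N).

Lemma measurable_first_symbols t : measurable (first_symbols @^-1` [set t]).
Proof.
case: t => a b; rewrite (_ : _ @^-1` _ =
    [set w : seqspace A | w 0%N = a] `*` [set w : seqspace A | w 0%N = b]).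
  by apply: measurableX; exact: measurable_coordinate.
apply/seteqP; split=> -[v w]; rewrite /first_symbols /=.
- by case=> <- <-.
- by case=> -> ->.
Qed.

End first_symbols.

(** * One stage: recoding by typical blocks at a fixed precision *)

Section stage.
Context {A : finPointedType} {R : realType}.
Local Notation X := (seqspace A).
Variables (x : X) (mu nu : probability X R) (xi : probability (X * X)%type R).
Variable nk : nat -> nat.
Hypothesis nk_gt0 : forall k, (0 < nk k)%N.
Hypothesis nk_ge : forall k, (k <= nk k)%N.
Hypothesis x_mu : semi_generates x mu nk.
Hypothesis nu_ergodic : ergodic_measure left_shift nu.
Let shift2 (z : X * X) : X * X := (left_shift z.1, left_shift z.2).
Hypothesis xi_invariant : measure_invariant shift2 xi.
Hypothesis xi_mu : forall C, measurable C -> xi (fst @^-1` C) = mu C.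
Hypothesis xi_nu : forall C, measurable C -> xi (snd @^-1` C) = nu C.
Variables (psi : A -> A -> R) (M : R).
Hypothesis psi_ge0 : forall a b, 0 <= psi a b.
Hypothesis psi_le : forall a b, psi a b <= M.
Hypothesis M_gt0 : 0 < M.
Variables (pattern : nat -> set X) (len : nat -> nat).
Hypothesis pattern_len : forall l, depends_on_prefix (len l) (pattern l).

Let psi_integral := \int[xi]_z psi (z.1 0%N) (z.2 0%N).

(** Only upward deviations are excluded: upper bounds are what survives concatenation, and they
    suffice for genericity in the end. *)
Definition atypical k e L : set X := [set z | exists2 l, (l < k)%N &
  L%:R * (fine (nu (pattern l)) + e) < birkhoff_sum left_shift \1_(pattern l) L z].

Lemma atypicalS k e L : atypical k.+1 e L = atypical k e L `|`
  [set z | L%:R * (fine (nu (pattern k)) + e) <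
           birkhoff_sum left_shift \1_(pattern k) L z].
Proof.
apply/seteqP; split=> [z [l lk zl]|z [[l lk zl]|zl]].
- by move: lk; rewrite ltnS leq_eqVlt => /predU1P[lk|lk]; [right; rewrite -lk|left; exists l].
- by exists l => //; exact: ltnW.
- by exists k.
Qed.

Lemma measurable_fun_pattern l : measurable_fun setT (\1_(pattern l) : X -> R).
Proof.
by apply: measurable_indic; exact: measurable_depends_on_prefix (@pattern_len l).
Qed.

Lemma measurable_atypical k e L : measurable (atypical k e L).
Proof.
elim: k => [|k IH].
  by rewrite (_ : atypical _ _ _ = set0)//; apply/seteqP; split=> // z [].
rewrite atypicalS; apply: measurableU => //; apply: measurable_superlevel.
by apply: measurable_birkhoff_sum; [exact: measurable_left_shift|exact: measurable_fun_pattern].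
Qed.

Lemma atypical_rare k e h : 0 < e -> 0 < h ->
  exists N, forall L, (N <= L)%N -> (nu (atypical k e L) < h%:E)%E.
Proof.
move=> e0; elim: k h => [|k IH] h h0.
  exists 0%N => L _; rewrite (_ : atypical _ _ _ = set0) ?measure0 ?lte_fin//.
  by apply/seteqP; split=> // z [].
have h2 : 0 < h / 2 by rewrite divr_gt0.
have [N1 N1P] := IH _ h2.
have indic1 z : `|\1_(pattern k) z : R| <= 1.
  by rewrite ger0_norm ?indic_ge0// indic_le1.
have [N2 N2P] := @ergodic_average_le _ _ _ nu left_shift measurable_left_shift
  (\1_(pattern k)) 1 e (h / 2) nu_ergodic (measurable_fun_pattern k)
  indic1 e0 h2.
exists (maxn N1 N2) => L; rewrite geq_max => /andP[/N1P L1 /N2P L2].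
rewrite Rintegral_indic in L2; last first.
  exact: measurable_depends_on_prefix (@pattern_len k).
rewrite atypicalS (splitr h) EFinD.
apply: (le_lt_trans _ (lteD L1 L2)); apply: measureU2.
  exact: measurable_atypical.
apply: measurable_superlevel.
by apply: measurable_birkhoff_sum; [exact: measurable_left_shift|exact: measurable_fun_pattern].
Qed.

Lemma measurable_shift2 : measurable_fun setT shift2.
Proof.
apply/measurable_fun_pair => /=.
- exact: measurableT_comp measurable_left_shift measurable_fst.
- exact: measurableT_comp measurable_left_shift measurable_snd.
Qed.

Let pair_objective (z : X * X) := psi (z.1 0%N) (z.2 0%N).

Lemma measurable_pair_objective : measurable_fun setT pair_objective.
Proof.
exact: (measurable_finite_valued (fun ab => psi ab.1 ab.2)
  measurable_first_symbols).
Qed.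

Lemma block_sum_birkhoff L (z : X * X) :
  block_sum psi (prefix L z.1) (prefix L z.2) =
  birkhoff_sum shift2 pair_objective L z.
Proof.
apply: eq_bigr => j _; rewrite !tnth_mktuple.
have -> : iter j shift2 z = (iter j left_shift z.1, iter j left_shift z.2).
  by elim: (nat_of_ord j) => [|k IH]; [case: z|rewrite iterS IH].
by rewrite /pair_objective /= !iter_left_shift !addn0.
Qed.

(** For a pair [z] with [z.2] typical, [z.2] itself competes in the maximum for the block of [z.1].
    For the remaining pairs the block sum is at most [L%:R * M], and they have measure below [h].
    Integrating against the invariant [xi] gives the bound. *)
Lemma best_sum_integral k e h L (best : L.-tuple A -> X) :
  (nu (atypical k e L) < h%:E)%E ->
  (forall u z, ~ atypical k e L z ->
    block_sum psi u (prefix L z) <= best_sum best psi u) ->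
  L%:R * (psi_integral - M * h) <=
  \sum_(u : L.-tuple A) best_sum best psi u * fine (mu (cylinder u)).
Proof.
move=> rare best_max; set B := atypical k e L in rare *.
have mB : measurable B by exact: measurable_atypical.
have m1 (u : L.-tuple A) : measurable ((fun z : X * X => prefix L z.1) @^-1` [set u]).
  by rewrite -[Y in measurable Y]setTI; exact: (measurable_fst measurableT _ (measurable_cylinder u)).
(* The integrand depends on [z.1] only, so the first marginal [mu] may be replaced by [xi]. *)
have -> : \sum_u best_sum best psi u * fine (mu (cylinder u)) =
    \int[xi]_z best_sum best psi (prefix L z.1).
  rewrite (Rintegral_finite_valued _ _ m1); apply: eq_bigr => u _.
  by rewrite -xi_mu//; exact: measurable_cylinder.
have mpsi := measurable_pair_objective.
have psiM z : `|pair_objective z| <= M by rewrite ger0_norm; [exact: psi_le|exact: psi_ge0].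
have msum : measurable_fun setT (birkhoff_sum shift2 pair_objective L).
  by apply: measurable_birkhoff_sum => //; exact: measurable_shift2.
have sumM z : `|birkhoff_sum shift2 pair_objective L z| <= L%:R * M.
  by rewrite -block_sum_birkhoff ger0_norm ?block_sum_ge0 ?block_sum_le.
have isum : xi.-integrable setT (EFin \o birkhoff_sum shift2 pair_objective L).
  exact: (@bounded_integrable _ _ _ _ _ (L%:R * M)).
have mB2 : measurable (snd @^-1` B : set (X * X)).
  by rewrite -[Y in measurable Y]setTI; exact: (measurable_snd measurableT _ mB).
have mI : measurable_fun setT (\1_(snd @^-1` B) : X * X -> R).
  exact: measurable_indic.
have LM0 : 0 <= L%:R * M by rewrite mulr_ge0// ltW.
have penM z : `|L%:R * M * (\1_(snd @^-1` B) z : R)| <= L%:R * M.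
  by rewrite normrM ger0_norm// ger0_norm ?indicE// ler_piMr// lern1 leq_b1.
have iI : xi.-integrable setT (EFin \o (fun z => L%:R * M * \1_(snd @^-1` B) z)).
  by apply: (@bounded_integrable _ _ _ _ _ (L%:R * M)) => //; exact: measurable_funM.
have iI1 : xi.-integrable setT (EFin \o (\1_(snd @^-1` B) : X * X -> R)).
  apply: (@bounded_integrable _ _ _ _ _ 1) => // z.
  by rewrite ger0_norm indicE// lern1 leq_b1.
have : \int[xi]_z (birkhoff_sum shift2 pair_objective L z -
      L%:R * M * \1_(snd @^-1` B) z) <=
    \int[xi]_z best_sum best psi (prefix L z.1).
  apply: le_Rintegral => //.
  - apply: (@bounded_integrable _ _ _ _ _ (L%:R * M + L%:R * M)).
      by apply: measurable_funB => //; exact: measurable_funM.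
    by move=> z; rewrite (le_trans (ler_normB _ _))// lerD.
  - exact: integrable_finite_valued.
  move=> z _; rewrite -block_sum_birkhoff indicE.
  have [zB|zB] := pselect (B z.2).
    rewrite mem_set// mulr1 (@le_trans _ _ 0) ?block_sum_ge0//.
    by rewrite subr_le0 block_sum_le.
  by rewrite memNset// mulr0 subr0; exact: best_max.
apply: le_trans; rewrite RintegralB// RintegralZl// Rintegral_indic//.
rewrite (@Rintegral_birkhoff_sum _ _ _ xi shift2 _ M)//; last first.
  exact: measurable_shift2.
rewrite mulrBr lerB// mulrA ler_wpM2l// -lee_fin fineK ?fin_num_measure//.
by rewrite xi_nu// ltW.
Qed.

Lemma average_prefix_cvg L (F : L.-tuple A -> R) : (0 < L)%N ->
  average (fun w => F (prefix L w)) (nk k) x @[k --> \oo] -->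
  \sum_u F u * fine (mu (cylinder u)).
Proof.
move=> L0.
have -> : (fun k => average (fun w => F (prefix L w)) (nk k) x) =
    (fun k => \sum_u F u * block_freq x u (nk k)).
  apply/funext => k; under eq_bigr do rewrite block_freqE mulrCA mulr_sumr.
  rewrite -mulr_sumr exchange_big/=; congr (_ * _); apply: eq_bigr => i _.
  rewrite (bigD1 (prefix L (iter i left_shift x)))//= indicE mem_set// mulr1.
  rewrite big1 ?addr0// => u ux; rewrite indicE memNset ?mulr0// => xu.
  by move: ux; rewrite -xu eqxx.
apply: cvg_sumr => u; apply: cvgM; first exact: cvg_cst.
exact: x_mu.
Qed.

Lemma stage k e : 0 < e -> exists c : nat, forall N, exists j w,
  [/\ (N <= j)%N,
      forall l s n, (l < k)%N -> (s <= n)%N ->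
        occurrences (pattern l) w s n <=
        (n - s)%:R * (fine (nu (pattern l)) + e) + c%:R &
      (nk j)%:R * (psi_integral - e) <= \sum_(0 <= i < nk j) psi (x i) (w i)].
Proof.
move=> e0; pose D := (\max_(l < k) len l)%N.
have e2 : 0 < e / 2 by rewrite divr_gt0.
have e3 : 0 < e / 3 by rewrite divr_gt0.
(* The first bound limits the loss [M * h] to [e / 3]; the second keeps the atypical set from having
   full measure, so that a typical sequence exists. *)
pose h := Num.min (e / 3 / M) 2^-1.
have h0 : 0 < h by rewrite lt_min divr_gt0//= invr_gt0.
have [N0 N0P] := atypical_rare k e2 h0.
(* Besides making atypical sequences rare, [L] is so large that the slack [D] for patterns
   straddling a block end costs at most [e / 2] per symbol. *)
pose L := maxn N0 (Num.truncn (D%:R / (e / 2))).+1.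
have L0 : (0 < L)%N by rewrite /L leq_max orbT.
have DL : D%:R <= L%:R * (e / 2).
  rewrite -ler_pdivrMr// (le_trans (ltW (truncnS_gt _)))// ler_nat.
  exact: leq_maxr.
have rare : (nu (atypical k (e / 2) L) < h%:E)%E by apply: N0P; exact: leq_maxl.
have typical : ~` atypical k (e / 2) L !=set0.
  apply/set0P/negP => /eqP E.
  have : (nu (atypical k (e / 2) L) < 1)%E.
    rewrite (lt_le_trans rare)// lee_fin ge_min; apply/orP; right.
    by rewrite invf_le1 ?ler1n.
  by rewrite -[atypical _ _ _]setCK E setC0 probability_setT ltxx.
have [best bestP] := exists_best_block psi L typical.
exists (2 * L)%N => N.
have best_int := best_sum_integral rare (fun u z => (bestP u).2 z).
have Fcvg := @average_prefix_cvg L (best_sum best psi) L0.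
(* The second third of [e] pays for convergence along [nk]; the last, in [jM], pays for the boundary
   term of [exists_offset]. *)
have Fgt : L%:R * (psi_integral - M * h) - L%:R * (e / 3) <
    \sum_u best_sum best psi u * fine (mu (cylinder u)).
  apply: lt_le_trans best_int; rewrite ltrBlDr ltrDl mulr_gt0// ltr0n//.
have [j0 _ j0P] := cvgr_gt _ Fcvg _ Fgt.
pose j := maxn (maxn N j0) (maxn L (Num.truncn ((2 * L)%:R * M / (e / 3))).+1).
have jn : (j <= nk j)%N by exact: nk_ge.
have Lj : (L <= nk j)%N.
  by apply: leq_trans jn; exact: leq_trans (leq_maxl L _) (leq_maxr _ _).
have jM : (2 * L)%:R * M <= (nk j)%:R * (e / 3).
  rewrite -ler_pdivrMr// (le_trans (ltW (truncnS_gt _)))// ler_nat.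
  by apply: leq_trans jn; rewrite /j !leq_max leqnn !orbT.
have [r rP] := exists_offset x best L0 psi_ge0 psi_le Lj.
exists j, (block_code x best r); split.
- exact: leq_trans (leq_maxl N j0) (leq_maxl _ _).
- move=> l s n lk sn.
  apply: (block_code_occurrences x L0 (@pattern_len l)) => //.
  + by rewrite addr_ge0 ?fine_ge0// ltW.
  + move=> u; have [typ _] := bestP u.
    have : birkhoff_sum left_shift \1_(pattern l) L (best u) <=
        L%:R * (fine (nu (pattern l)) + e / 2).
      by rewrite leNgt; apply/negP => h1; apply: typ; exists l.
    have : (len l)%:R <= D%:R :> R by rewrite ler_nat (leq_bigmax (Ordinal lk)).
    lra.
- have nk0 : 0 < (nk j)%:R :> R by rewrite ltr0n.
  have L0' : 0 < L%:R :> R by rewrite ltr0n.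
  have j0j : (j0 <= j)%N by exact: leq_trans (leq_maxr N j0) (leq_maxl _ _).
  have := j0P j j0j; rewrite /= -(ltr_pM2l nk0) => /ltW.
  have -> : (nk j)%:R * average (fun w => best_sum best psi (prefix L w)) (nk j) x =
      \sum_(0 <= s < nk j) best_sum best psi (block x L s).
    by rewrite /average mulrA mulfV ?gt_eqF// mul1r big_mkord.
  move=> sum_ge; rewrite -(ler_pM2l L0'); apply: le_trans rP.
  have Mh : M * h <= e / 3.
    by rewrite mulrC -ler_pdivlMr// ge_min lexx.
  have h1 : (nk j)%:R * L%:R * (M * h) <= (nk j)%:R * L%:R * (e / 3).
    by rewrite ler_wpM2l// mulr_ge0// ltW.
  have h2 : L%:R * ((2 * L)%:R * M) <= L%:R * ((nk j)%:R * (e / 3)).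
    by rewrite ler_wpM2l// ltW.
  lra.
Qed.

End stage.

(** * Passing to finer and finer recodings *)

Section concatenation.
Context {A : finPointedType} {R : realType}.
Local Notation X := (seqspace A).
Variables (x : X) (nk : nat -> nat) (psi : A -> A -> R) (M I : R).
Hypothesis nk_ge : forall k, (k <= nk k)%N.
Hypothesis psi_ge0 : forall a b, 0 <= psi a b.
Hypothesis psi_le : forall a b, psi a b <= M.
Variables (pattern : nat -> set X) (len : nat -> nat) (freq : nat -> R).
Hypothesis pattern_len : forall l, depends_on_prefix (len l) (pattern l).
Hypothesis freq_ge0 : forall l, 0 <= freq l.
Hypothesis stages : forall k (e : R), 0 < e ->
  exists c : nat, forall N, exists j w,
  [/\ (N <= j)%N,
      forall l s n, (l < k)%N -> (s <= n)%N ->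
        occurrences (pattern l) w s n <= (n - s)%:R * (freq l + e) + c%:R &
      (nk j)%:R * (I - e) <= \sum_(0 <= i < nk j) psi (x i) (w i)].

(** The sequence [y] follows the stage [W k], of precision [eps k], on the interval from [T k] to
    [T k.+1]. Each switching time dwarfs the previous one and the constants of the two adjacent
    stages. It is also a value of [nk], where the objective of the stage is controlled. *)
Lemma concatenate_stages : exists y : X,
  (forall l (e : R), 0 < e -> exists N, forall n, (N <= n)%N ->
     occurrences (pattern l) y 0 n <= n%:R * (freq l + e)) /\
  (forall (e : R) N, 0 < e -> exists2 j, (N <= j)%N &
     (nk j)%:R * (I - e) <= \sum_(0 <= i < nk j) psi (x i) (y i)).
Proof.
pose eps k : R := k.+1%:R^-1.
have eps_gt0 k : 0 < eps k by rewrite invr_gt0 ltr0n.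
have eps_le k k' : (k <= k')%N -> eps k' <= eps k.
  by move=> kk'; rewrite lef_pV2 ?posrE ?ltr0n// ler_nat.
have eps_small (e : R) : 0 < e -> exists k0, forall k, (k0 <= k)%N -> eps k <= e.
  move=> e0; exists (Num.truncn e^-1) => k k0k.
  rewrite invf_ple ?posrE ?ltr0n// (le_trans (ltW (truncnS_gt _)))// ler_nat.
  exact: k0k.
have /choice[c cP] := fun k => stages k (eps_gt0 k).
have /choice[jw jwP] : forall kN : nat * nat, exists jw : nat * X,
  [/\ (kN.2 <= jw.1)%N,
      forall l s n, (l < kN.1)%N -> (s <= n)%N ->
        occurrences (pattern l) jw.2 s n <=
        (n - s)%:R * (freq l + eps kN.1) + (c kN.1)%:R &
      (nk jw.1)%:R * (I - eps kN.1) <=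
        \sum_(0 <= i < nk jw.1) psi (x i) (jw.2 i)].
  by move=> [k N]; have [j [w]] := cP k N; exists (j, w).
pose m := (Num.truncn M).+1.
have Mm : M <= m%:R by rewrite ltW// truncnS_gt.
(* With [t = T k]: the terms absorb the uncontrolled occurrences before [t], the constants of the
   stages [k] and [k.+1], and the objective [m * t] possibly lost before [t]. The factor [k.+1]
   makes their sum at most a fraction [eps k] of [T k.+1], and the final successor makes [T]
   increase strictly. *)
pose bnd k t := (k.+1 * (t + c k + c k.+1 + m * t))%N.+1.
pose T := fix T k := if k is k'.+1 then nk (jw (k', bnd k' (T k'))).1 else 0%N.
pose J k := (jw (k, bnd k (T k))).1; pose W k := (jw (k, bnd k (T k))).2.
have TS k : T k.+1 = nk (J k) by [].
have T0 : T 0%N = 0%N by [].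
have [bndJ W_occ W_sum] : [/\ forall k, (bnd k (T k) <= J k)%N,
    forall k l s n, (l < k)%N -> (s <= n)%N -> occurrences (pattern l) (W k) s n <=
        (n - s)%:R * (freq l + eps k) + (c k)%:R &
    forall k, (T k.+1)%:R * (I - eps k) <=
        \sum_(0 <= i < T k.+1) psi (x i) (W k i)].
  by split=> k; have [] := jwP (k, bnd k (T k)).
clearbody J W; clearbody T; clear jwP cP.
have bndT k : (bnd k (T k) <= T k.+1)%N by rewrite TS (leq_trans (bndJ k)).
have T_lt k : (T k < T k.+1)%N.
  apply: leq_trans (bndT k); rewrite ltnS /bnd mulSn -!addnA.
  exact: leq_addr.
have T_le : {homo T : k k' / (k <= k')%N}.
  by apply: homo_leq => // [k2 k1 k3|k]; [exact: leq_trans|exact: ltnW].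
have T_ge k : (k <= T k)%N.
  by elim: k => // k IH; exact: leq_ltn_trans (T_lt k).
have /choice[K KP] : forall i, exists k, (T k <= i < T k.+1)%N.
  elim=> [|i [k /andP[ki ik]]]; first by exists 0%N; rewrite T0 (leq_ltn_trans _ (T_lt 0%N)).
  have [ik'|ki'] := ltnP i.+1 (T k.+1).
    by exists k; rewrite ik' leqW.
  by exists k.+1; rewrite ki' (leq_ltn_trans ik (T_lt _)).
have K_uniq k i : (T k <= i < T k.+1)%N -> K i = k.
  move=> /andP[ki ik]; have /andP[Ki iK] := KP i.
  apply/eqP; rewrite eqn_leq; apply/andP; split; rewrite leqNgt; apply/negP => /T_le h.
  - by move: (leq_trans h Ki); rewrite leqNgt ik.
  - by move: (leq_trans h ki); rewrite leqNgt iK.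
pose y : X := fun i => W (K i) i.
have yW k i : (T k <= i < T k.+1)%N -> y i = W k i by move=> /K_uniq ki; rewrite /y ki.
exists y; split=> [l e e0|e N e0].
- have e3 : 0 < e / 3 by rewrite divr_gt0.
  have [k0 k0P] := eps_small _ e3.
  pose k1 := maxn k0 l.+1.
  (* Cutting the count at [T k.+1] and at [n] costs [len l] each time. *)
  pose N1 := (Num.truncn ((2 * len l)%:R / (e / 3))).+1.
  exists (maxn (T k1.+1) N1) => n; rewrite geq_max => /andP[k1n N1n].
  have /andP[Kn nK] := KP n.
  have k1K : (k1 < K n)%N.
    rewrite ltnNge; apply/negP => Kk1.
    have := T_le (K n).+1 k1.+1 Kk1; rewrite leqNgt => /negP; apply.
    exact: leq_ltn_trans k1n nK.
  (* Now [n] lies in stage [k.+1]. Only the stages [k] and [k.+1] are counted precisely, and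
     everything before [T k] is bounded by its length. *)
  move: Kn nK k1K; case: (K n) => // k Kn nK k1K; rewrite ltnS in k1K.
  have lk : (l < k)%N by rewrite (leq_trans _ k1K)// leq_maxr.
  have ek : eps k <= e / 3 by apply: k0P; rewrite (leq_trans _ k1K)// leq_maxl.
  have Tk := ltnW (T_lt k).
  have lenn : (2 * len l)%:R <= n%:R * (e / 3).
    by rewrite -ler_pdivrMr// (le_trans (ltW (truncnS_gt _)))// ler_nat.
  have bn : (T k + c k + c k.+1)%:R <= n%:R * (e / 3).
    apply: (@le_trans _ _ (n%:R * eps k)); last by rewrite ler_wpM2l.
    rewrite ler_pdivlMr ?ltr0n// -natrM ler_nat mulnC.
    apply: leq_trans Kn; apply: leq_trans (bndT k); rewrite leqW// leq_mul2l/=.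
    exact: leq_addr.
  have occ1 := W_occ k l (T k) (T k.+1) lk Tk.
  have occ2 := W_occ k.+1 l (T k.+1) n (ltnW lk) Kn.
  rewrite (@occurrences_cat _ _ _ _ 0 (T k) n)//; last exact: leq_trans Kn.
  rewrite (@occurrences_cat _ _ _ _ (T k) (T k.+1) n)//.
  have h0 := @occurrences_le A R (pattern l) y 0 (T k).
  have h1 : occurrences (pattern l) y (T k) (T k.+1) <=
      occurrences (pattern l) (W k) (T k) (T k.+1) + (len l)%:R :> R.
    by apply: occurrences_agree => [|i]; [exact: pattern_len|exact: yW].
  have h2 : occurrences (pattern l) y (T k.+1) n <=
      occurrences (pattern l) (W k.+1) (T k.+1) n + (len l)%:R :> R.
    apply: occurrences_agree => [|i /andP[ki kin]]; first exact: pattern_len.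
    by apply: yW; rewrite ki (ltn_trans kin nK).
  have epsS : eps k.+1 <= e / 3 by apply: le_trans ek; exact: eps_le.
  rewrite natrB// in occ1; rewrite natrB// in occ2; rewrite subn0 in h0.
  have u0 : 0 <= (T k.+1)%:R - (T k)%:R :> R by rewrite subr_ge0 ler_nat.
  have v0 : 0 <= n%:R - (T k.+1)%:R :> R by rewrite subr_ge0 ler_nat.
  have h3 : ((T k.+1)%:R - (T k)%:R) * (freq l + eps k) <=
            ((T k.+1)%:R - (T k)%:R) * (freq l + e / 3).
    by rewrite ler_wpM2l// lerD2l.
  have h4 : (n%:R - (T k.+1)%:R) * (freq l + eps k.+1) <=
            (n%:R - (T k.+1)%:R) * (freq l + e / 3).
    by rewrite ler_wpM2l// lerD2l.
  have h5 : 0 <= (T k)%:R * (freq l + e / 3) by rewrite mulr_ge0// addr_ge0// ltW.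
  rewrite !natrD in bn; rewrite natrM in lenn.
  move: h0 h1 h2 h3 h4 h5 bn lenn occ1 occ2; clear.
  lra.
- have e2 : 0 < e / 2 by rewrite divr_gt0.
  have [k0 k0P] := eps_small _ e2.
  pose k := maxn k0 N; have ek : eps k <= e / 2 by apply: k0P; exact: leq_maxl.
  exists (J k).
    apply: leq_trans (leq_maxr k0 N) _; apply: leq_trans (bndJ k).
    by rewrite (leq_trans (T_ge k))// leqW// mulSn -!addnA leq_addr.
  have Tk := ltnW (T_lt k); have := W_sum k; rewrite -TS.
  rewrite !(@big_cat_nat _ _ _ (T k) 0 (T k.+1))//= => sumW.
  (* At time [T k.+1] the sequences [y] and [W k] differ only before [T k], where [W k] earns at
     most [M] per symbol and [y] at least [0]. *)
  have h1 : \sum_(0 <= i < T k) psi (x i) (W k i) <= (T k)%:R * M.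
    rewrite mulr_natl -[T k in leRHS]subn0 -sumr_const_nat.
    exact: ler_sum.
  have h2 : 0 <= \sum_(0 <= i < T k) psi (x i) (y i) by exact: sumr_ge0.
  have h3 : \sum_(T k <= i < T k.+1) psi (x i) (y i) =
            \sum_(T k <= i < T k.+1) psi (x i) (W k i).
    by apply: eq_big_nat => i /yW ->.
  have h4 : (T k)%:R * M <= (T k.+1)%:R * (e / 2).
    apply: (@le_trans _ _ ((T k.+1)%:R * eps k)); last by rewrite ler_wpM2l.
    apply: (@le_trans _ _ ((T k)%:R * m%:R)); first by rewrite ler_wpM2l.
    rewrite ler_pdivlMr ?ltr0n// -!natrM ler_nat.
    apply: leq_trans (bndT k); rewrite leqW// mulnC leq_mul2l/= mulnC.
    exact: leq_addl.
  have h5 : (T k.+1)%:R * eps k <= (T k.+1)%:R * (e / 2) by rewrite ler_wpM2l.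
  rewrite h3; move: h1 h2 h4 h5 sumW; clear.
  lra.
Qed.

End concatenation.

(** * Positive upper limits, and convergence from upper bounds *)

Section sequences.
Context {R : realType}.

Lemma limn_sup_gt0P (u : nat -> R) (b : R) : (forall n, 0 <= u n <= b) ->
  0 < limn_sup u <-> exists2 d, 0 < d & forall N, exists2 n, (N <= n)%N & d <= u n.
Proof.
move=> ub; have u_bnd : bounded_fun (u : nat -> R^o).
  exists b; split; first exact: num_real.
  move=> y /ltW; have := ub; clear => ub by_ n _.
  have /andP[u0 /le_trans/(_ by_)] := ub n.
  by rewrite -{1}(ger0_norm u0).
rewrite limn_supE//; set I := inf _.
have lb : has_lbound (range (sups u)) by exact: bounded_fun_has_lbound_sups.
have drop_ub N : has_ubound (sdrop u N).
  by exists b => _ [n _ <-]; have /andP[] := ub n.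
split=> [I0|[d d0 ud]].
  exists (I / 2); first by rewrite divr_gt0.
  move=> N; have : I / 2 < sups u N.
    apply: (@lt_le_trans _ _ I); first by rewrite ltr_pdivrMr// ltr_pMr// ltr1n.
    by apply: ge_inf => //; exists N.
  have dropN0 : sdrop u N !=set0 by exists (u N), N => /=.
  by move=> /(sup_gt dropN0)[_ [n Nn <-]] /ltW; exists n.
apply: (lt_le_trans d0); apply: lb_le_inf; first by exists (sups u 0%N), 0%N.
move=> _ [N _ <-]; have [n Nn dn] := ud N.
by apply: (le_trans dn); apply: ub_le_sup => //; exists n.
Qed.

(** Totals agree, so if every other term exceeds its target by at most [e / #|I|], the remaining
    term cannot fall short by more than [e]. *)
Lemma cvg_of_upper_bounds (I : finType) (u : I -> nat -> R) (a : I -> R) :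
  (forall n, \sum_i u i n = \sum_i a i) ->
  (forall i e, 0 < e -> \forall n \near \oo, u i n <= a i + e) ->
  forall i, u i n @[n --> \oo] --> a i.
Proof.
move=> sum_ua ua i; apply/cvgrPdist_le => e e0.
pose e' := e / #|I|%:R.
have I0 : 0 < #|I|%:R :> R by rewrite ltr0n; apply/card_gt0P; exists i.
have e'0 : 0 < e' by rewrite divr_gt0.
have e'e : e' <= e.
  have I1 : 1 <= #|I|%:R :> R by rewrite ler1n -(ltr0n R).
  by rewrite ler_pdivrMr//; apply: ler_peMr => //; exact: ltW.
apply: filterS (@filter_forall _ _ _ _ _ (fun j => ua j _ e'0)) => n uan.
have := uan i => ui; rewrite ler_distlC.
apply/andP; split; last by rewrite (le_trans ui)// lerD2l.
have := sum_ua n; rewrite (bigD1 i)//= [RHS](bigD1 i)//= => sumE.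
have : \sum_(j | j != i) u j n <= \sum_(j | j != i) a j + e.
  apply: (@le_trans _ _ (\sum_(j | j != i) (a j + e'))); first exact: ler_sum.
  rewrite big_split lerD2l/= sumr_const -[e' *+ _]mulr_natl mulrC.
  rewrite /e' -mulrA mulrC -ler_pdivlMr ?divff ?gt_eqF//.
  by rewrite mulrC ler_pdivrMr// mul1r ler_nat max_card.
lra.
Qed.

End sequences.

(** * Averages of symbols and block frequencies *)

Section averages_of_symbols.
Context {A : finPointedType} {R : realType}.
Local Notation X := (seqspace A).

Lemma average_finite_valued (T : finType) (f : X -> T) (g : T -> R) n z :
  average (fun w => g (f w)) n z =
  \sum_t g t * average \1_(f @^-1` [set t]) n z.
Proof.
under eq_bigr do rewrite mulrCA mulr_sumr.
rewrite -mulr_sumr exchange_big/=; congr (_ * _); apply: eq_bigr => i _.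
rewrite (bigD1 (f (iter i left_shift z)))//= indicE mem_set// mulr1.
rewrite big1 ?addr0// => u ux; rewrite indicE memNset ?mulr0// => xu.
by move: ux; rewrite -xu eqxx.
Qed.

Lemma average_first_cvg (P : probability X R) (z : X) I (F : set_system I)
    (n_ : I -> nat) (g : A -> R) : Filter F ->
  (forall a, average \1_[set w : X | w 0%N = a] (n_ i) z @[i --> F] -->
    fine (P [set w : X | w 0%N = a])) ->
  average (fun w => g (w 0%N)) (n_ i) z @[i --> F] --> \int[P]_w g (w 0%N).
Proof.
move=> FF cvgz.
rewrite (Rintegral_finite_valued P g (f := fun w : X => w 0%N)); last first.
  by move=> a; exact: measurable_coordinate.
under eq_fun do rewrite (@average_finite_valued _ (fun w : X => w 0%N)).
by apply: cvg_sumr => a; apply: cvgM; [exact: cvg_cst|exact: cvgz].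
Qed.

Lemma cylinder1 (a : A) : cylinder [tuple a] = [set w : X | w 0%N = a].
Proof.
apply/seteqP; split=> w /= => [wa|wa].
  by have := congr1 (fun B => tnth B ord0) wa; rewrite tnth_mktuple.
by apply: eq_from_tnth => i; rewrite tnth_mktuple !ord1.
Qed.

Lemma semi_generates_first (P : probability X R) (z : X) (nk : nat -> nat)
    (g : A -> R) : semi_generates z P nk ->
  average (fun w => g (w 0%N)) (nk k) z @[k --> \oo] --> \int[P]_w g (w 0%N).
Proof.
move=> zP; apply: average_first_cvg => a; rewrite -cylinder1.
by under eq_fun do rewrite -block_freqE; exact: zP.
Qed.

Lemma sum_block_freq (z : X) m n :
  \sum_(B : m.-tuple A) block_freq z B n.+1 = 1 :> R.
Proof.
rewrite -[RHS](average_cst 1 n z).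
rewrite (@average_finite_valued _ (prefix m) (fun=> 1)).
by apply: eq_bigr => B _; rewrite block_freqE mul1r.
Qed.

Lemma sum_cylinder (P : probability X R) m :
  \sum_(B : m.-tuple A) fine (P (cylinder B)) = 1.
Proof.
have := Rintegral_finite_valued P (fun=> 1) (f := @prefix A m).
rewrite Rintegral_cst// mul1r [X in fine X](_ : _ = 1%E)/=; last exact: probability_setT.
move=> ->; last by move=> B; exact: measurable_cylinder.
by apply: eq_bigr => B _; rewrite mul1r.
Qed.

(** For each length [m] the block frequencies and the cylinder measures both add up to one, so upper
    bounds force convergence. *)
Lemma generic_of_upper_bounds (P : probability X R) (y : X) :
  (forall m (B : m.-tuple A) e, 0 < e -> exists N, forall n, (N <= n)%N ->
     occurrences (cylinder B) y 0 n <= n%:R * (fine (P (cylinder B)) + e)) ->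
  generic y P.
Proof.
move=> yP m B _; move: B; apply: cvg_of_upper_bounds => [n|B e e0].
  by rewrite sum_block_freq sum_cylinder.
have [N NP] := yP m B e e0; exists N => // n /= Nn.
rewrite block_freqE /average ler_pdivrMl ?ltr0n//.
have := NP n.+1 (leqW Nn); rewrite /occurrences big_mkord; exact.
Qed.

End averages_of_symbols.

(** * Lifting joinings and correlations *)

Lemma lift_joining {A : finPointedType} {R : realType} (x : seqspace A)
    (mu nu : probability (seqspace A) R)
    (xi : probability (seqspace A * seqspace A)%type R)
    (nk : nat -> nat) (psi : A -> A -> R) :
  (forall k, (0 < nk k)%N) -> {homo nk : i j / (i < j)%N} ->
  semi_generates x mu nk -> ergodic_measure left_shift nu ->
  measure_invariant (fun z => (left_shift z.1, left_shift z.2)) xi ->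
  (forall C, measurable C -> xi (fst @^-1` C) = mu C) ->
  (forall C, measurable C -> xi (snd @^-1` C) = nu C) ->
  exists y : seqspace A, generic y nu /\
    forall (e : R) N, 0 < e -> exists2 j, (N <= j)%N &
      (nk j)%:R * (\int[xi]_z psi (z.1 0%N) (z.2 0%N) - e) <=
      \sum_(0 <= i < nk j) psi (x i) (y i).
Proof.
move=> nk_gt0 nk_inc x_mu nu_erg xi_inv xi_mu xi_nu.
have nk_ge k : (k <= nk k)%N.
  by elim: k => // k IH; apply: (leq_ltn_trans IH); exact: nk_inc.
(* A bound for [psi] on the finite alphabet. Adding [b] makes the objective nonnegative, as the
   stages require, and shifts both sides of the final inequality equally; the extra [1] in the upper
   bound makes that bound positive. *)
pose b := \sum_(p : A * A) `|psi p.1 p.2|.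
have b0 : 0 <= b by exact: sumr_ge0.
have psi_b a a' : `|psi a a'| <= b.
  by rewrite /b (bigD1 (a, a'))//= lerDl sumr_ge0.
pose psi' a a' := psi a a' + b.
have psi'_ge0 a a' : 0 <= psi' a a'.
  by rewrite /psi' -lerBlDr sub0r; have := psi_b a a'; rewrite ler_norml => /andP[].
have psi'_le a a' : psi' a a' <= b + b + 1.
  rewrite /psi'; have := psi_b a a'; rewrite ler_norml => /andP[_]; lra.
have M_gt0 : 0 < b + b + 1 by rewrite ltr_wpDl// addr_ge0.
(* All blocks of all lengths, enumerated by their codes; a number that codes no block gets the empty
   pattern. *)
pose pattern l : set (seqspace A) :=
  if @choice.unpickle {m : nat & m.-tuple A} l is Some B then cylinder (tagged B) else set0.
pose len l := if @choice.unpickle {m : nat & m.-tuple A} l is Some B then tag B else 0%N.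
have pattern_len l : depends_on_prefix (len l) (pattern l).
  rewrite /len /pattern; case: choice.unpickle => [[m B]|//].
  exact: depends_on_cylinder.
have stages := stage nk_gt0 nk_ge x_mu nu_erg xi_inv xi_mu xi_nu psi'_ge0 psi'_le
  M_gt0 pattern_len.
have [y [y_freq y_sum]] := concatenate_stages nk_ge psi'_ge0 psi'_le pattern_len
  (fun l => fine_ge0 (measure_ge0 nu _)) stages.
exists y; split.
  apply: generic_of_upper_bounds => m B e e0.
  have := y_freq (choice.pickle (Tagged (fun m => m.-tuple A) B)) e e0.
  by rewrite /pattern choice.pickleK.
move=> e N e0; have [j Nj sum_ge] := y_sum e N e0; exists j => //; move: sum_ge.
have intE : \int[xi]_z psi' (z.1 0%N) (z.2 0%N) =
    \int[xi]_z psi (z.1 0%N) (z.2 0%N) + b.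
  rewrite RintegralD//.
  - rewrite Rintegral_cst// [X in fine X](_ : _ = 1%E)/= ?mulr1//.
    exact: probability_setT.
  - exact: (integrable_finite_valued xi (fun ab => psi ab.1 ab.2)
      measurable_first_symbols).
  - exact: (@bounded_integrable _ _ _ _ _ `|b|).
rewrite intE big_split/= sumr_const_nat subn0 -[b *+ _]mulr_natl; lra.
Qed.

(** * Complex numbers through real and imaginary parts *)

Section complex_numbers.
Context {R : realType}.
Implicit Types (z w : R[i]).
Local Notation Re := complex.Re.
Local Notation Im := complex.Im.

Lemma ReD z w : Re (z + w) = Re z + Re w. Proof. by case: z; case: w. Qed.
Lemma ImD z w : Im (z + w) = Im z + Im w. Proof. by case: z; case: w. Qed.
Lemma ReB z w : Re (z - w) = Re z - Re w. Proof. by case: z; case: w. Qed.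
Lemma ImB z w : Im (z - w) = Im z - Im w. Proof. by case: z; case: w. Qed.
Lemma ReM z w : Re (z * w) = Re z * Re w - Im z * Im w.
Proof. by case: z; case: w. Qed.
Lemma ImM z w : Im (z * w) = Re z * Im w + Im z * Re w.
Proof. by case: z => a b; case: w => c d /=; rewrite [b * c]mulrC. Qed.

Lemma Re_sum (I : Type) (r : seq I) (F : I -> R[i]) :
  Re (\sum_(i <- r) F i) = \sum_(i <- r) Re (F i).
Proof. exact: (big_morph _ ReD). Qed.
Lemma Im_sum (I : Type) (r : seq I) (F : I -> R[i]) :
  Im (\sum_(i <- r) F i) = \sum_(i <- r) Im (F i).
Proof. exact: (big_morph _ ImD). Qed.

Lemma natV_complex n : n%:R^-1 = (n%:R^-1 : R)%:C.
Proof. by rewrite fmorphV rmorph_nat. Qed.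

Lemma abs_Re_le z : `|Re z| <= normc z.
Proof.
case: z => a b /=; rewrite -(sqrtr_sqr a) ler_wsqrtr//.
by rewrite lerDl sqr_ge0.
Qed.

Lemma abs_Im_le z : `|Im z| <= normc z.
Proof.
case: z => a b /=; rewrite -(sqrtr_sqr b) ler_wsqrtr//.
by rewrite lerDr sqr_ge0.
Qed.

Lemma normc_le z : normc z <= `|Re z| + `|Im z|.
Proof.
case: z => a b /=; rewrite -[leRHS]ger0_norm ?addr_ge0// -sqrtr_sqr.
rewrite ler_wsqrtr// sqrrD !real_normK ?num_real//.
by rewrite [leRHS]addrAC lerDl mulrn_wge0// mulr_ge0.
Qed.

Lemma normc_ge0 z : 0 <= normc z. Proof. by case: z => a b; exact: sqrtr_ge0. Qed.

Lemma normc_conj z : normc z^* = normc z.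
Proof. by case: z => a b /=; rewrite sqrrN. Qed.

Lemma le_normcB z w : normc (z - w) <= normc z + normc w.
Proof. by rewrite -[normc w]normcN le_normcD. Qed.

Lemma normc_mean_le (w : nat -> R[i]) n : (forall i, normc (w i) <= 1) ->
  normc (n.+1%:R^-1 * \sum_(i < n.+1) w i) <= 1.
Proof.
move=> w1; rewrite natV_complex normcM.
have -> : normc (n.+1%:R^-1 : R)%:C = n.+1%:R^-1.
  by rewrite /= expr0n addr0 sqrtr_sqr ger0_norm// invr_ge0.
rewrite ler_pdivrMl ?ltr0n// mulr1.
rewrite -[n.+1 in leRHS]card_ord -sumr_const.
elim/big_ind2 : _ => [|a b c d ab cd|i _]; last exact: w1.
- by rewrite normc0.
- exact: le_trans (le_normcD _ _) (lerD ab cd).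
Qed.

Lemma Re_mean (w : nat -> R[i]) n :
  Re (n%:R^-1 * \sum_(i < n) w i) = n%:R^-1 * \sum_(i < n) Re (w i).
Proof. by rewrite natV_complex ReM/= mul0r subr0 Re_sum. Qed.

Lemma Im_mean (w : nat -> R[i]) n :
  Im (n%:R^-1 * \sum_(i < n) w i) = n%:R^-1 * \sum_(i < n) Im (w i).
Proof. by rewrite natV_complex ImM/= mul0r addr0 Im_sum. Qed.

End complex_numbers.

(** * Pairs of sequences as sequences of pairs *)

Section pairs.
Context {A : finPointedType} {R : realType}.

Definition fst_seq (z : seqspace (A * A)%type) : seqspace A := fun i => (z i).1.
Definition snd_seq (z : seqspace (A * A)%type) : seqspace A := fun i => (z i).2.
Definition unzip_seq z := (fst_seq z, snd_seq z).

Lemma measurable_fst_seq : measurable_fun setT fst_seq.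
Proof.
apply: measurable_fun_seqspace => j a; apply: measurable_clopen.
by exists j.+1 => z w /prefixP zw; rewrite /fst_seq /= zw.
Qed.

Lemma measurable_snd_seq : measurable_fun setT snd_seq.
Proof.
apply: measurable_fun_seqspace => j a; apply: measurable_clopen.
by exists j.+1 => z w /prefixP zw; rewrite /snd_seq /= zw.
Qed.

Lemma measurable_unzip_seq : measurable_fun setT unzip_seq.
Proof.
apply/measurable_fun_pair => /=; first exact: measurable_fst_seq.
exact: measurable_snd_seq.
Qed.

Lemma clopen_fst_seq C : clopen_set C -> clopen_set (fst_seq @^-1` C).
Proof.
move=> [m Cm]; exists m => z w /prefixP zw; apply: Cm; apply/prefixP => j jm.
by rewrite /fst_seq zw.
Qed.

Lemma clopen_snd_seq C : clopen_set C -> clopen_set (snd_seq @^-1` C).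
Proof.
move=> [m Cm]; exists m => z w /prefixP zw; apply: Cm; apply/prefixP => j jm.
by rewrite /snd_seq zw.
Qed.

Lemma average_fst_seq (g : seqspace A -> R) n z :
  average (fun w => g (fst_seq w)) n z = average g n (fst_seq z).
Proof. by congr (_ * _); apply: eq_bigr => i _; rewrite !iter_left_shift. Qed.

Lemma average_snd_seq (g : seqspace A -> R) n z :
  average (fun w => g (snd_seq w)) n z = average g n (snd_seq z).
Proof. by congr (_ * _); apply: eq_bigr => i _; rewrite !iter_left_shift. Qed.

End pairs.

(** * Correlation of sequences and of measures *)

Section correlation.
Context {R : realType} {K : {fset R[i]}} {K0 : K != fset0}.
Local Notation A := (alphabet K0).
Local Notation X := (seqspace A).
Local Notation Re := complex.Re.
Local Notation Im := complex.Im.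
Hypothesis Kdisc : forall z : R[i], z \in K -> normc z <= 1.

Lemma normc_symbol (a : A) : normc (symbol a) <= 1.
Proof. exact/Kdisc/fsvalP. Qed.

Definition mean (w : nat -> R[i]) n : R[i] := n%:R^-1 * \sum_(i < n) w i.

Lemma block_corrE (u v : nat -> R[i]) n :
  block_corr [tuple u i | i < n] [tuple v i | i < n] =
  mean (fun i => u i * (v i)^*) n - mean u n * mean (fun i => (v i)^*) n.
Proof.
rewrite /block_corr /mean; congr (_ * _ - _ * _ * (_ * _));
  by apply: eq_bigr => i _; rewrite !tnth_mktuple.
Qed.

Lemma Re_mean_average (B : finPointedType) (g : B -> R[i]) n (z : seqspace B) :
  Re (mean (fun i => g (z i)) n) = average (fun w => Re (g (w 0%N))) n z.
Proof.
rewrite Re_mean; congr (_ * _); apply: eq_bigr => i _.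
by rewrite iter_left_shift addn0.
Qed.

Lemma Im_mean_average (B : finPointedType) (g : B -> R[i]) n (z : seqspace B) :
  Im (mean (fun i => g (z i)) n) = average (fun w => Im (g (w 0%N))) n z.
Proof.
rewrite Im_mean; congr (_ * _); apply: eq_bigr => i _.
by rewrite iter_left_shift addn0.
Qed.

Lemma normc_block_corr_le (x y : X) n :
  normc (block_corr [tuple values x i | i < n.+1] [tuple values y i | i < n.+1])
  <= 2.
Proof.
rewrite block_corrE; apply: (le_trans (le_normcB _ _)).
have x1 i : normc (values x i) <= 1 by exact: normc_symbol.
have y1 i : normc (values y i)^* <= 1 by rewrite normc_conj; exact: normc_symbol.
have h1 : normc (mean (fun i => values x i * (values y i)^*) n.+1) <= 1.
  apply: normc_mean_le => i; rewrite normcM.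
  exact: mulr_ile1 (normc_ge0 _) (normc_ge0 _) (x1 i) (y1 i).
have h2 : normc (mean (values x) n.+1) * normc (mean (fun i => (values y i)^*) n.+1) <= 1.
  by apply: mulr_ile1; rewrite ?normc_ge0//; exact: normc_mean_le.
rewrite [X in _ + X]normcM; lra.
Qed.

Lemma weakly_correlatedP (x y : X) : weakly_correlated (values x) (values y) <->
  exists2 d, 0 < d & forall N, exists2 n, (N <= n)%N & d <=
    normc (block_corr [tuple values x i | i < n.+1] [tuple values y i | i < n.+1]).
Proof.
apply: (@limn_sup_gt0P _ _ 2) => n.
by rewrite normc_ge0 normc_block_corr_le.
Qed.

Definition joining_corr (mu nu : probability X R) (xi : probability (X * X)%type R) :=
  cintegral xi (fun z : X * X => values z.1 0%N * (values z.2 0%N)^*)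
  - cintegral mu (fun x : X => values x 0%N)
    * cintegral nu (fun y : X => (values y 0%N)^*).

(** A crude bound, one for each of the real and imaginary parts; it serves to show that the set
    defining [measure_corr] is bounded. *)
Lemma normc_cintegral_le d (T : measurableType d) (P : probability T R)
    (f : T -> R[i]) :
  measurable_fun setT (fun t => Re (f t)) ->
  measurable_fun setT (fun t => Im (f t)) ->
  (forall t, normc (f t) <= 1) -> normc (cintegral P f) <= 2.
Proof.
move=> mRe mIm f1; rewrite (le_trans (normc_le _))//=.
have bound (g : T -> R) : measurable_fun setT g -> (forall t, `|g t| <= 1) ->
    `|\int[P]_t g t| <= 1.
  move=> mg g1; have ig := @bounded_integrable _ _ _ P _ _ mg g1.
  rewrite (le_trans (le_normr_Rintegral _ _))//.
  rewrite (@le_trans _ _ (\int[P]_t 1))//.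
    apply: le_Rintegral => //.
    - apply: (@bounded_integrable _ _ _ _ _ 1); last by move=> t; rewrite normr_id.
      exact: measurableT_comp.
    - by apply: (@bounded_integrable _ _ _ _ _ 1) => // t; rewrite normr1.
  by rewrite Rintegral_cst// mul1r [X in fine X](_ : _ = 1%E)//=; exact: probability_setT.
have := bound _ mRe (fun t => le_trans (abs_Re_le _) (f1 t)).
have := bound _ mIm (fun t => le_trans (abs_Im_le _) (f1 t)).
lra.
Qed.

Lemma measurable_first (g : A -> R) :
  measurable_fun setT (fun w : X => g (w 0%N)).
Proof.
apply: (measurable_finite_valued g (f := fun w : X => w 0%N)) => a.
exact: measurable_coordinate.
Qed.

Lemma measurable_first_pair (g : A -> A -> R) :
  measurable_fun setT (fun z : X * X => g (z.1 0%N) (z.2 0%N)).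
Proof.
exact: (measurable_finite_valued (fun ab => g ab.1 ab.2) measurable_first_symbols).
Qed.

Lemma normc_joining_corr_le mu nu xi : normc (joining_corr mu nu xi) <= 6.
Proof.
apply: (le_trans (le_normcB _ _)).
have h1 : normc (cintegral xi (fun z : X * X => values z.1 0%N * (values z.2 0%N)^*)) <= 2.
  apply: normc_cintegral_le.
  - exact: (measurable_first_pair (fun a b => Re (symbol a * (symbol b)^*))).
  - exact: (measurable_first_pair (fun a b => Im (symbol a * (symbol b)^*))).
  - move=> z; rewrite normcM normc_conj.
    by apply: mulr_ile1; rewrite ?normc_ge0//; exact: normc_symbol.
have h2 : normc (cintegral mu (fun x : X => values x 0%N)) <= 2.
  apply: normc_cintegral_le.
  - exact: (measurable_first (fun a => Re (symbol a))).
  - exact: (measurable_first (fun a => Im (symbol a))).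
  - by move=> z; exact: normc_symbol.
have h3 : normc (cintegral nu (fun x : X => (values x 0%N)^*)) <= 2.
  apply: normc_cintegral_le.
  - exact: (measurable_first (fun a => Re (symbol a)^*)).
  - exact: (measurable_first (fun a => Im (symbol a)^*)).
  - by move=> z; rewrite normc_conj; exact: normc_symbol.
have := ler_pM (normc_ge0 _) (normc_ge0 _) h2 h3.
rewrite [X in _ + X]normcM; lra.
Qed.

Lemma correlatedP mu nu : correlated mu nu <->
  exists2 xi, joining mu nu xi & joining_corr mu nu xi <> 0.
Proof.
split=> [corr|[xi xij xi0] corr0].
- apply: contrapT => H; apply: corr; rewrite /measure_corr; set S := (X in sup X).
  have S0 : S `<=` [set 0].
    move=> _ [xi xij <-].
    have [E|/eqP xi0] := eqVneq (joining_corr mu nu xi) 0.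
      by have := congr1 (@normc R) E; rewrite normc0.
    by exfalso; apply: H; exists xi.
  (* If every joining gives [0], the set is empty or the singleton of [0]; the supremum of the empty
     set is [0] by convention. *)
  by have [->|->] := subset_set1 S0; rewrite ?sup0 ?sup1.
- have : normc (joining_corr mu nu xi) <= measure_corr mu nu.
    apply: ub_le_sup; last by exists xi.
    by exists 6 => _ [xi' _ <-]; exact: normc_joining_corr_le.
  rewrite corr0 => h; apply: xi0; apply: eq0_normc.
  by apply/eqP; rewrite eq_le h normc_ge0.
Qed.

(** A complex correlation is tested by a real functional: [D w] is the real part of the conjugate of
    [c] times [w], positive at [c]. Lifting the joining for the objective [D] bounds the mean of the
    products from below, while the separate means converge by semi-genericity of [x] and genericity
    of [y]. *)
Lemma corr_of_correlated (x : X) (mu nu : probability X R) :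
  semi_generic x mu -> ergodic_measure left_shift nu -> correlated mu nu ->
  exists y : X, generic y nu /\ weakly_correlated (values x) (values y).
Proof.
move=> [nk [nk_gt0 nk_inc x_mu]] nu_erg /correlatedP[xi [xi_inv xi_mu xi_nu] c0].
set c := joining_corr mu nu xi in c0.
have [p [q [pE qE]]] : exists p q, p = Re c /\ q = Im c by exists (Re c), (Im c).
pose D (w : R[i]) := p * Re w + q * Im w.
have Dc : 0 < D c.
  rewrite /D pE qE -!expr2 lt_neqAle addr_ge0 ?sqr_ge0// andbT eq_sym.
  rewrite paddr_eq0 ?sqr_ge0// !sqrf_eq0; apply/negP => /andP[/eqP h1 /eqP h2].
  have cz (w : R[i]) : Re w = 0 -> Im w = 0 -> w = 0 by case: w => a b /= -> ->.
  exact: c0 (cz _ h1 h2).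
pose psi (a b : A) := D (symbol a * (symbol b)^*).
have [y [y_gen y_sum]] := lift_joining psi nk_gt0 nk_inc x_mu nu_erg xi_inv xi_mu xi_nu.
exists y; split=> //; apply/weakly_correlatedP.
have nk_ge k : (k <= nk k)%N.
  by elim: k => // k IH; apply: (leq_ltn_trans IH); exact: nk_inc.
have y_nu : semi_generates y nu nk.
  move=> m B m0; apply/cvgrPdist_lt => e e0.
  have /cvgrPdist_lt /(_ e e0) [N _ NP] := y_gen m B m0.
  (* Genericity is stated for lengths [n.+1], so the length [nk k] is reached at the index
     [(nk k).-1]. *)
  exists N.+1 => // k /= Nk; have := NP (nk k).-1; rewrite /= prednK//; apply.
  by have := leq_trans Nk (nk_ge k); case: (nk k) (nk_gt0 k).
pose m1 := cintegral mu (fun x : X => values x 0%N).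
pose m2 := cintegral nu (fun y : X => (values y 0%N)^*).
pose u k := mean (values x) (nk k).
pose v k := mean (fun i => (values y i)^*) (nk k).
have Re_u : Re (u k) @[k --> \oo] --> Re m1.
  have := @semi_generates_first A R _ _ _ (fun a : A => Re (symbol a)) x_mu.
  by under eq_fun do rewrite -(@Re_mean_average A (@symbol _ _ K0)).
have Im_u : Im (u k) @[k --> \oo] --> Im m1.
  have := @semi_generates_first A R _ _ _ (fun a : A => Im (symbol a)) x_mu.
  by under eq_fun do rewrite -(@Im_mean_average A (@symbol _ _ K0)).
have Re_v : Re (v k) @[k --> \oo] --> Re m2.
  have := @semi_generates_first A R _ _ _ (fun a : A => Re (symbol a)^*) y_nu.
  by under eq_fun do rewrite -(@Re_mean_average A (fun a => (symbol a)^*)).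
have Im_v : Im (v k) @[k --> \oo] --> Im m2.
  have := @semi_generates_first A R _ _ _ (fun a : A => Im (symbol a)^*) y_nu.
  by under eq_fun do rewrite -(@Im_mean_average A (fun a => (symbol a)^*)).
have D_uv : D (u k * v k) @[k --> \oo] --> D (m1 * m2).
  have -> : (fun k => D (u k * v k)) = (fun k =>
      p * (Re (u k) * Re (v k) - Im (u k) * Im (v k)) +
      q * (Re (u k) * Im (v k) + Im (u k) * Re (v k))).
    by apply/funext => k; rewrite /D (ReM (u k)) (ImM (u k)).
  rewrite /D (ReM m1) (ImM m1); apply: cvgD; (apply: cvgM; first exact: cvg_cst).
  - by apply: cvgB; [exact: cvgM Re_u Re_v|exact: cvgM Im_u Im_v].
  - by apply: cvgD; [exact: cvgM Re_u Im_v|exact: cvgM Im_u Re_v].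
(* One quarter of [D c] is lost in the lifted sum and one in the product of the means, so half of it
   remains. *)
have e0 : 0 < D c / 4 by rewrite divr_gt0.
have [N1 _ N1P] : \forall k \near \oo, D (u k * v k) < D (m1 * m2) + D c / 4.
  by apply: cvgr_lt D_uv _ _; rewrite ltrDl.
(* A Lipschitz constant of [D], made positive by the [1], which converts the bound on [D] into one
   on the modulus. *)
pose s := `|p| + `|q| + 1.
have s0 : 0 < s by rewrite ltr_wpDl// addr_ge0.
have D_le w : D w <= s * normc w.
  have h1 : p * Re w <= `|p| * normc w.
    rewrite (le_trans (ler_norm _))// normrM ler_wpM2l//; exact: abs_Re_le.
  have h2 : q * Im w <= `|q| * normc w.
    rewrite (le_trans (ler_norm _))// normrM ler_wpM2l//; exact: abs_Im_le.
  have := normc_ge0 w; rewrite /D /s; lra.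
exists (D c / 2 / s); first by rewrite !divr_gt0.
move=> N; have [j Nj sum_ge] := y_sum (D c / 4) (maxn N.+1 N1) e0.
move: Nj; rewrite geq_max => /andP[Nj /N1P /= uv_lt].
exists (nk j).-1; first by have := leq_trans Nj (nk_ge j); case: (nk j) (nk_gt0 j).
rewrite prednK// ler_pdivrMr// [leRHS]mulrC; apply: le_trans (D_le _).
rewrite block_corrE -/(u j) -/(v j).
have DB w w' : D (w - w') = D w - D w' by rewrite /D ReB ImB; lra.
set g := mean _ (nk j).
have Dg : D g = (nk j)%:R^-1 * \sum_(0 <= i < nk j) psi (x i) (y i).
  rewrite /D Re_mean Im_mean big_mkord !mulr_sumr -big_split/=.
  by apply: eq_bigr => i _; rewrite /psi /D /values; ring.
have intD : \int[xi]_z psi (z.1 0%N) (z.2 0%N) =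
    D (cintegral xi (fun z : X * X => values z.1 0%N * (values z.2 0%N)^*)).
  have iRe : xi.-integrable setT (EFin \o (fun z : X * X =>
      Re (values z.1 0%N * (values z.2 0%N)^*))).
    exact: (integrable_finite_valued xi
      (fun ab => Re (symbol ab.1 * (symbol ab.2)^*)) measurable_first_symbols).
  have iIm : xi.-integrable setT (EFin \o (fun z : X * X =>
      Im (values z.1 0%N * (values z.2 0%N)^*))).
    exact: (integrable_finite_valued xi
      (fun ab => Im (symbol ab.1 * (symbol ab.2)^*)) measurable_first_symbols).
  rewrite /psi /D RintegralD//.
  - by rewrite !RintegralZl.
  - exact: (integrable_finite_valued xi
      (fun ab => p * Re (symbol ab.1 * (symbol ab.2)^*)) measurable_first_symbols).
  - exact: (integrable_finite_valued xi
      (fun ab => q * Im (symbol ab.1 * (symbol ab.2)^*)) measurable_first_symbols).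
have cE : D c = D (cintegral xi (fun z : X * X => values z.1 0%N * (values z.2 0%N)^*))
    - D (m1 * m2) by rewrite -DB.
move: sum_ge; rewrite (DB g) intD -ler_pdivlMl ?ltr0n// -Dg.
clearbody D; move: cE uv_lt; set I := cintegral xi _.
move: (D c) (D I) (D g) (D (m1 * m2)) (D (u j * v j)); clear => *; lra.
Qed.

Lemma Rintegral_finite_pushforward d d' (S : measurableType d) (S' : measurableType d')
    (P : probability S R) (Q : probability S' R) (h : S -> S') (T : finType)
    (f : S' -> T) (g : T -> R) :
  (forall C, measurable C -> Q C = P (h @^-1` C)) ->
  (forall t, measurable (f @^-1` [set t])) ->
  (forall t, measurable ((f \o h) @^-1` [set t])) ->
  \int[Q]_y g (f y) = \int[P]_x g (f (h x)).
Proof.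
move=> QP mf mfh; rewrite (Rintegral_finite_valued Q g mf).
rewrite (Rintegral_finite_valued P g mfh).
by apply: eq_bigr => t _; rewrite QP.
Qed.

(** The empirical averages of the pair [(x, y)] converge, along an ultrafilter on times of large
    correlation, to an invariant measure [P] on sequences of pairs. Unzipping [P] gives a joining of
    its first marginal [mu] with [nu], and its correlation is the limit of the block
    correlations. *)
Lemma correlated_of_corr (x y : X) (nu : probability X R) :
  generic y nu -> weakly_correlated (values x) (values y) ->
  exists mu : probability X R,
    [/\ measure_invariant left_shift mu, semi_generic x mu & correlated mu nu].
Proof.
move=> y_nu /weakly_correlatedP[d d0 corr_d].
have [U UU [ooU US]] := eventually_ultrafilter corr_d.
pose z : seqspace (A * A)%type := fun i => (x i, y i).
have [P [P_inv P_lim]] := empirical_limit_measure (R := R) z UU ooU.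
have [xi xiP] := pushforward_probability P measurable_unzip_seq.
have [mu muP] := pushforward_probability P measurable_fst_seq.
have [nu' nu'P] := pushforward_probability P measurable_snd_seq.
have mfst C : measurable C -> measurable (fst_seq @^-1` C : set (seqspace (A * A)%type)).
  by move=> mC; rewrite -[Y in measurable Y]setTI; exact: (measurable_fst_seq measurableT mC).
have munzip C : measurable C -> measurable (unzip_seq @^-1` C : set (seqspace (A * A)%type)).
  by move=> mC; rewrite -[Y in measurable Y]setTI; exact: (measurable_unzip_seq measurableT mC).
(* The second marginal is [nu]: the frequencies of the generic [y] converge to it along [\oo], hence
   also along [U], where limits are unique. *)
have nuP C : measurable C -> nu C = P (snd_seq @^-1` C).
  move=> mC; rewrite -nu'P; apply/esym; move: C mC; apply: eq_measure_cylinder => m B m0.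
  have mB := measurable_cylinder B.
  rewrite -[LHS]fineK ?fin_num_measure// -[RHS]fineK ?fin_num_measure//; congr (_%:E).
  have y_nuU : block_freq y B n.+1 @[n --> U] --> fine (nu (cylinder B)).
    by have := y_nu m B m0; apply: cvg_trans => V; exact: ooU.
  apply: cvg_unique y_nuU => //.
  rewrite nu'P (_ : (fun n => block_freq y B n.+1) =
    (fun n => average \1_(snd_seq @^-1` cylinder B) n.+1 z)).
    exact: P_lim _ (clopen_snd_seq (clopen_cylinder B)).
  apply/funext => n; rewrite block_freqE.
  exact/esym/(@average_snd_seq A R \1_(cylinder B) n.+1 z).
exists mu; split.
- by move=> C mC; rewrite !muP -(P_inv _ (mfst _ mC)).
- have mu_lim (B : {m : nat & m.-tuple A}) :
      block_freq x (tagged B) n.+1 @[n --> U] --> fine (mu (cylinder (tagged B))).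
    rewrite muP (_ : (fun n => block_freq x (tagged B) n.+1) =
      (fun n => average \1_(fst_seq @^-1` cylinder (tagged B)) n.+1 z)).
      exact: P_lim _ (clopen_fst_seq (clopen_cylinder (tagged B))).
    apply/funext => n; rewrite block_freqE.
    exact/esym/(@average_fst_seq A R \1_(cylinder (tagged B)) n.+1 z).
  (* There are countably many blocks, so the limits along [U] are realized along one subsequence of
     lengths. *)
  have [nk [nk_inc nkP]] := common_subsequence _ ooU mu_lim.
  exists (fun k => (nk k).+1); split=> // m B _.
  exact: (nkP (Tagged (fun m => m.-tuple A) B)).
- apply/correlatedP; exists xi.
    split.
    + by move=> C mC; rewrite !xiP -(P_inv _ (munzip _ mC)).
    + by move=> C mC; rewrite xiP muP.
    + by move=> C mC; rewrite xiP nuP.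
  move=> c0.
  pose s1 (p : A * A) := symbol p.1; pose s2 (p : A * A) := (symbol p.2)^*.
  have lim_mean (g : A * A -> R) :
      average (fun w : seqspace (A * A)%type => g (w 0%N)) n.+1 z @[n --> U] -->
      \int[P]_w g (w 0%N).
    by apply: average_first_cvg => a; apply: P_lim; exact: clopen_coordinate.
  have xiE (g : A -> A -> R) : \int[xi]_w g (w.1 0%N) (w.2 0%N) =
      \int[P]_w g (w 0%N).1 (w 0%N).2.
    apply: (@Rintegral_finite_pushforward _ _ _ _ P xi unzip_seq _ first_symbols
      (fun ab => g ab.1 ab.2)) => [C _||t]; first exact: xiP.
      exact: measurable_first_symbols.
    exact: (munzip _ (measurable_first_symbols t)).
  have muE (g : A -> R) : \int[mu]_w g (w 0%N) = \int[P]_w g (w 0%N).1.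
    apply: (@Rintegral_finite_pushforward _ _ _ _ P mu fst_seq _
      (fun w : X => w 0%N) g) => [C _|a|a]; first exact: muP.
      exact: measurable_coordinate.
    exact: (mfst _ (measurable_coordinate 0%N a)).
  have nuE (g : A -> R) : \int[nu]_w g (w 0%N) = \int[P]_w g (w 0%N).2.
    apply: (@Rintegral_finite_pushforward _ _ _ _ P nu snd_seq _
      (fun w : X => w 0%N) g) => [C mC|a|a]; first exact: nuP.
      exact: measurable_coordinate.
    exact: measurable_clopen (clopen_snd_seq (clopen_coordinate 0%N a)).
  pose g n := mean (fun i => s1 (z i) * s2 (z i)) n.+1.
  pose u n := mean (fun i => s1 (z i)) n.+1.
  pose v n := mean (fun i => s2 (z i)) n.+1.
  pose lg := cintegral P (fun w : seqspace (A * A)%type => s1 (w 0%N) * s2 (w 0%N)).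
  pose lu := cintegral P (fun w : seqspace (A * A)%type => s1 (w 0%N)).
  pose lv := cintegral P (fun w : seqspace (A * A)%type => s2 (w 0%N)).
  have Re_lim (h : A * A -> R[i]) : Re (mean (fun i => h (z i)) n.+1) @[n --> U] -->
      Re (cintegral P (fun w : seqspace (A * A)%type => h (w 0%N))).
    have := lim_mean (fun p => Re (h p)).
    by under eq_fun do rewrite -Re_mean_average.
  have Im_lim (h : A * A -> R[i]) : Im (mean (fun i => h (z i)) n.+1) @[n --> U] -->
      Im (cintegral P (fun w : seqspace (A * A)%type => h (w 0%N))).
    have := lim_mean (fun p => Im (h p)).
    by under eq_fun do rewrite -Im_mean_average.
  (* The joining correlation, assumed zero for contradiction, rewritten as an expression in
     integrals against [P]. *)
  have lE : lg - lu * lv = 0.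
    rewrite -c0; congr (_ - _ * _); congr (_ +i* _); apply/esym.
    - exact: (xiE (fun a b => Re (symbol a * (symbol b)^*))).
    - exact: (xiE (fun a b => Im (symbol a * (symbol b)^*))).
    - exact: (muE (fun a => Re (symbol a))).
    - exact: (muE (fun a => Im (symbol a))).
    - exact: (nuE (fun a => Re (symbol a)^*)).
    - exact: (nuE (fun a => Im (symbol a)^*)).
  have Re_corr : Re (g n - u n * v n) @[n --> U] --> (0 : R).
    rewrite (_ : 0 = Re lg - (Re lu * Re lv - Im lu * Im lv)); last first.
      by rewrite -(ReM lu) -(ReB lg) lE.
    rewrite (_ : (fun n => _) = (fun n => Re (g n) -
        (Re (u n) * Re (v n) - Im (u n) * Im (v n)))); last first.
      by apply/funext => n; rewrite (ReB (g n)) (ReM (u n)).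
    apply: cvgB; first exact: (Re_lim (fun p => s1 p * s2 p)).
    apply: cvgB; apply: cvgM.
    + exact: (Re_lim s1).
    + exact: (Re_lim s2).
    + exact: (Im_lim s1).
    + exact: (Im_lim s2).
  have Im_corr : Im (g n - u n * v n) @[n --> U] --> (0 : R).
    rewrite (_ : 0 = Im lg - (Re lu * Im lv + Im lu * Re lv)); last first.
      by rewrite -(ImM lu) -(ImB lg) lE.
    rewrite (_ : (fun n => _) = (fun n => Im (g n) -
        (Re (u n) * Im (v n) + Im (u n) * Re (v n)))); last first.
      by apply/funext => n; rewrite (ImB (g n)) (ImM (u n)).
    apply: cvgB; first exact: (Im_lim (fun p => s1 p * s2 p)).
    apply: cvgD; apply: cvgM.
    + exact: (Re_lim s1).
    + exact: (Im_lim s2).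
    + exact: (Im_lim s1).
    + exact: (Re_lim s2).
  (* Real and imaginary parts below [d / 2] give a modulus below [d], contradicting the choice of
     times in [U]. *)
  have d2 : 0 < d / 2 by rewrite divr_gt0.
  have /cvgrPdist_lt /(_ _ d2) Re_small := Re_corr.
  have /cvgrPdist_lt /(_ _ d2) Im_small := Im_corr.
  have [n [/= dn [re im]]] := filter_ex (filterI US (filterI Re_small Im_small)).
  rewrite block_corrE in dn; rewrite sub0r normrN in re; rewrite sub0r normrN in im.
  have := le_trans dn (normc_le _); rewrite leNgt => /negP; apply.
  by rewrite [ltRHS](splitr d); apply: ltrD.
Qed.

End correlation.

Theorem theorem4p2 (R : realType) (K : {fset R[i]}) (K0 : K != fset0)
    (Kdisc : forall z : R[i], z \in K -> normc z <= 1)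
    (x : seqspace (alphabet K0)) :
  (exists y : seqspace (alphabet K0),
     (exists nu : probability (seqspace (alphabet K0)) R,
        ergodic_measure left_shift nu /\ generic y nu) /\
     weakly_correlated (values x) (values y))
  <->
  (exists mu : probability (seqspace (alphabet K0)) R,
     [/\ measure_invariant left_shift mu, semi_generic x mu &
         exists nu : probability (seqspace (alphabet K0)) R,
           ergodic_measure left_shift nu /\ correlated mu nu]).
Proof.
split=> [[y [[nu [nu_erg y_nu]] xy]]|[mu [mu_inv x_mu [nu [nu_erg mu_nu]]]]].
- have [mu [mu_inv x_mu mu_nu]] := correlated_of_corr Kdisc y_nu xy.
  by exists mu; split=> //; exists nu.
- have [y [y_nu xy]] := corr_of_correlated Kdisc x_mu nu_erg mu_nu.
  by exists y; split=> //; exists nu.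
Qed.
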